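(* Let $L$ be an even positive-definite lattice of rank $k$, $V_L$ its lattice VOA, $V_L^+$ the fixed-point subVOA of the canonical involution, and $h_1,\dots,h_k$ an orthonormal basis of $H=\mathbf C\otimes L$. Let $p$ be even, $n_1,\dots,n_p$ positive integers, $i_1,\dots,i_p\in\{1,\dots,k\}$, and $u=h_{i_1}[-n_1]\cdots h_{i_p}[-n_p]\mathbf 1\in V_L^+$. Let $\Lambda=\{j\in\{1,\dots,p\}: n_j=1\}$ and for $\Delta\subseteq\Lambda$ let $P_\Delta(\alpha)=\prod_{j\in\Delta}(h_{i_j},\alpha)$. Then \[ Z_{V_L^+}(u,\tau)=\Big(\sum_{\sigma\in\mathrm{Inv}_0(\{1,\dots,p\})}\prod_{(rs)}\delta_{i_r,i_s}\widehat F_{n_r+n_s}(\tau)\Big)\Big(Z_{V_L^+}(\tau)-\tfrac12Z_{V_L}(\tau)\Big)+\frac12\sum_{\Delta\subseteq\Lambda}\frac{\theta_L(\tau,P_\Delta)}{\eta(\tau)^k}\sum_{\sigma\in\mathrm{Inv}_0(\{1,\dots,p\}\setminus\Delta)}\prod_{(rs)}\delta_{i_r,i_s}\widehat E_{n_r+n_s}(\tau), \] where in each case the product ranges over the transpositions $(rs)$ whose product is $\sigma$.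
   Context: $V_L=\bigoplus_{\alpha\in L}M\otimes e^\alpha$ with $M$ the Heisenberg VOA on $H$; the involution acts by $h_{j_1}(-m_1)\cdots h_{j_q}(-m_q)\mathbf 1\otimes e^\beta\mapsto(-1)^qh_{j_1}(-m_1)\cdots h_{j_q}(-m_q)\mathbf 1\otimes e^{-\beta}$, and $V_L^+$ is its fixed-point subVOA. Square bracket modes: $Y[v,z]=\sum_nv[n]z^{-n-1}:=Y(e^{zL(0)}v,e^z-1)$. Zero mode $o(v)=v(w-1)$ for $v$ of weight $w$. For $W=V_L$ or $V_L^+$, $Z_W(u,\tau)=\mathrm{Tr}_Wo(u)q^{L(0)-k/24}$, $Z_W(\tau)=Z_W(\mathbf1,\tau)$, $q=e^{2\pi i\tau}$; $\eta$ is the Dedekind eta function. For a function $P:L\to\mathbf C$, $\theta_L(\tau,P)=\sum_{\alpha\in L}P(\alpha)q^{(\alpha,\alpha)/2}$. For a finite set $A$, $\mathrm{Inv}_0(A)$ is the set of fixed-point-free involutions of $A$ (for $A=\emptyset$ it consists of the identity; empty products are $1$). $E_k(\tau)=-\frac{B_k}{k!}+\frac{2}{(k-1)!}\sum_{n\ge1}\sigma_{k-1}(n)q^n$ for even $k$, $E_k=0$ for odd $k$, $F_k(\tau)=2E_k(2\tau)-E_k(\tau)$; for positive integers $a,b$, $\widehat E_{a+b}=(-1)^{b+1}b\binom{a+b-1}{b}E_{a+b}$ and $\widehat F_{a+b}=(-1)^{b+1}b\binom{a+b-1}{b}F_{a+b}$. *)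

(* Defs.v *)
From HB Require Import structures.
From mathcomp Require Import all_boot all_order all_algebra perm.
From mathcomp Require Import finmap multiset.
From mathcomp Require Import boolp classical_sets fsbigop.
From mathcomp Require Import complex Rstruct.

Set Implicit Arguments.
Unset Strict Implicit.
Unset Printing Implicit Defensive.
Import Order.TTheory GRing.Theory Num.Theory.
Local Open Scope mset_scope.
Local Open Scope ring_scope.

Notation C := (complex Rdefinitions.R).

Definition pseries := nat -> C.
Definition ps_zero : pseries := fun _ => 0.
Definition ps_one : pseries := fun n => (n == 0%N)%:R.
Definition ps_add (f g : pseries) : pseries := fun n => f n + g n.
Definition ps_scale (c : C) (f : pseries) : pseries := fun n => c * f n.
Definition ps_mul (f g : pseries) : pseries :=
  fun n => \sum_(i < n.+1) f i * g (n - i)%N.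

Fixpoint ps_inv_aux (f : pseries) (n : nat) : seq C :=
  match n with
  | 0%N => [:: (f 0%N)^-1]
  | n'.+1 => let s := ps_inv_aux f n' in
      rcons s (- (f 0%N)^-1 * \sum_(i < n'.+1) f i.+1 * nth 0 s (n' - i)%N)
  end.
Definition ps_inv (f : pseries) : pseries := fun n => nth 0 (ps_inv_aux f n) n.

Definition ps_ipow (f : pseries) (j : int) : pseries :=
  match j with
  | Posz m => iter m (ps_mul f) ps_one
  | Negz m => iter m.+1 (ps_mul (ps_inv f)) ps_one
  end.

(** e^z and g(z) := (e^z - 1)/z. *)
Definition ps_exp : pseries := fun n => (n`!)%:R^-1.
Definition ps_g : pseries := fun n => (n.+1`!)%:R^-1.

(** * Square-bracket coefficients.
   For h of weight 1, Y[h,z] = Y(e^z h, e^z - 1) = sum_m h(m) e^z (e^z-1)^{-m-1},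
   hence h[n] = sum_m sbcoef n m * h(m), where sbcoef n m is the coefficient
   of z^{-n-1} in the Laurent series e^z (e^z-1)^{-m-1} = z^{-m-1} e^z g(z)^{-m-1}. *)
Definition sbcoef (n m : int) : C :=
  if n <= m then ps_mul ps_exp (ps_ipow ps_g (- m - 1)) (absz (m - n)) else 0.

(** z/(e^z-1) = sum_n B_n z^n / n! *)
Definition bernoulli (n : nat) : C := (n`!)%:R * ps_inv ps_g n.

Definition Eis (k : nat) : pseries := fun N =>
  if odd k then 0
  else if N == 0%N then - bernoulli k / (k`!)%:R
  else 2 / ((k.-1)`!)%:R * \sum_(d <- divisors N) (d ^ k.-1)%:R.

(** F_k(tau) = 2 E_k(2 tau) - E_k(tau). *)
Definition Fis (k : nat) : pseries := fun N =>
  2 * (if ~~ odd N then Eis k N./2 else 0) - Eis k N.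

Definition hatc (a b : nat) : C := (-1) ^+ b.+1 * (b * 'C(a + b - 1, b))%:R.
Definition Ehat (a b : nat) : pseries := ps_scale (hatc a b) (Eis (a + b)).
Definition Fhat (a b : nat) : pseries := ps_scale (hatc a b) (Fis (a + b)).

(** eta: eta(tau) = q^{1/24} prod_{n>=1} (1 - q^n).  etaprod is the power series
   prod_{n>=1}(1-q^n) (its q^N coefficient only involves the factors n <= N),
   and etainv k = q^{k/24} / eta^k = (prod (1-q^n))^{-k}. *)
Definition etaprod : pseries :=
  fun N => (\prod_(m < N) (1 - 'X^(m.+1) : {poly C}))`_N.
Definition etainv (k : nat) : pseries := ps_ipow etaprod (- (k%:Z)).

(** * The lattice L = Z^k with Gram matrix G, and H = C (x) L = C^k. *)
Definition lform k (G : 'M[int]_k) (a b : 'rV[int]_k) : int := (a *m G *m b^T) 0 0.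

(** rows of B are the coordinates of h_1..h_k in the lattice basis;
    hpair G B a beta = (h_a, beta) (bilinear extension of the form). *)
Definition hpair k (G : 'M[int]_k) (B : 'M[C]_k) (a : 'I_k) (beta : 'rV[int]_k) : C :=
  (B *m map_mx intr G *m (map_mx intr beta)^T) a 0.

(** theta_L(tau, P) = sum_alpha P(alpha) q^{(alpha,alpha)/2}
    (finite sum for each coefficient since G is positive definite). *)
Definition thetaL k (G : 'M[int]_k) (P : 'rV[int]_k -> C) : pseries := fun N =>
  \sum_(al \in [set al : 'rV[int]_k | lform G al al = (2 * N)%:Z]) P al.

(** * The lattice VOA V_L = (+)_beta M (x) e^beta.
   Basis vectors: pairs (beta, mu), mu a multiset of (a, m) standing for the
   monomial  prod_{(a,m) in mu} h_a(-(m+1)) 1 (x) e^beta. *)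
Definition monom k : Type := {mset ('I_k * nat)}.
Definition fbasis k := ('rV[int]_k * monom k)%type.
Definition fvec k := fbasis k -> C.

Definition deltaB k (y : fbasis k) : fvec k := fun x => (x == y)%:R.
Definition vac k : fvec k := deltaB (0, mset0).

Definition wt k (G : 'M[int]_k) (x : fbasis k) : int :=
  ((lform G x.1 x.1) %/ 2)%Z + (\sum_(e <- enum_mset x.2) e.2.+1)%N%:Z.

(** Heisenberg modes h_a(n) acting on V_L:
    h_a(-(m+1)) creates, h_a(m+1) annihilates (with [h_a(m),h_b(n)] = m delta_ab
    delta_{m+n,0}), h_a(0) acts on M (x) e^beta by (h_a, beta). *)
Definition hmode k (G : 'M[int]_k) (B : 'M[C]_k) (a : 'I_k) (n : int)
    (f : fvec k) : fvec k := fun x =>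
  match n with
  | Negz m => if (a, m) \in x.2 then f (x.1, (x.2 `\ (a, m))%mset) else 0
  | Posz 0 => hpair G B a x.1 * f x
  | Posz m.+1 => (m.+1 * (x.2 (a, m)).+1)%N%:R * f (x.1, ((a, m) +` x.2)%mset)
  end.

(** square-bracket modes h_a[n] = sum_m sbcoef n m h_a(m)
    (for each coefficient only finitely many terms are nonzero on the
    finitely supported vectors considered here). *)
Definition hbrack k (G : 'M[int]_k) (B : 'M[C]_k) (a : 'I_k) (n : int)
    (f : fvec k) : fvec k := fun x =>
  \sum_(m \in [set: int]) sbcoef n m * hmode G B a m f x.

Definition sb_state k (G : 'M[int]_k) (B : 'M[C]_k) (s : seq ('I_k * nat)) : fvec k :=
  foldr (fun an v => hbrack G B an.1 (- (an.2%:Z)) v) (@vac k) s.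

Definition gbinom (x : int) (m : nat) : C :=
  (\prod_(i < m) (x - i%:Z)%:~R) / (m`!)%:R.

Definition nord k (G : 'M[int]_k) (B : 'M[C]_k) (s : seq ('I_k * int))
    (f : fvec k) : fvec k :=
  foldr (fun an g => hmode G B an.1 an.2 g) f
        ([seq an <- s | an.2 < 0] ++ [seq an <- s | 0 <= an.2]).

(** Zero mode o(v) = v(wt v - 1) of the monomial v = prod h_{a_i}(-(m_i+1)) 1:
    Y(v,z) = : prod_i d^{(m_i)} h_{a_i}(z) :  with
    d^{(m)} h(z) = sum_n binom(-n-1, m) h(n) z^{-n-1-m}, so the coefficient of
    z^{-wt v} is the sum over (n_i) with sum n_i = 0. *)
Definition zmode_mono k (G : 'M[int]_k) (B : 'M[C]_k) (mu : monom k)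
    (f : fvec k) : fvec k := fun x =>
  \sum_(ns \in [set ns : seq int | size ns = size (enum_mset mu)
                                  /\ \sum_(j <- ns) j = 0])
     (\prod_(pr <- zip (enum_mset mu) ns) gbinom (- pr.2 - 1) pr.1.2)
     * nord G B [seq (pr.1.1, pr.2) | pr <- zip (enum_mset mu) ns] f x.

(** zero mode o(v) for v in M = M (x) e^0, extended linearly *)
Definition zmode k (G : 'M[int]_k) (B : 'M[C]_k) (v : fvec k) (f : fvec k) : fvec k :=
  fun x => \sum_(mu \in [set: monom k]) v (0, mu) * zmode_mono G B mu f x.

(** the canonical involution
    h(-m_1)...h(-m_q) 1 (x) e^beta |-> (-1)^q h(-m_1)...h(-m_q) 1 (x) e^{-beta} *)
Definition theta k (f : fvec k) : fvec k :=
  fun x => (-1) ^+ size (enum_mset x.2) * f (- x.1, x.2).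

(** Graded traces.  The series below gives the coefficients of
    q^{N - k/24}, i.e. it is q^{k/24} Z_W(v, tau) as a power series in q.
    Z_{V_L}(v,tau): trace of o(v) on the weight-N space of V_L. *)
Definition ZVL k (G : 'M[int]_k) (B : 'M[C]_k) (v : fvec k) : pseries := fun N =>
  \sum_(x \in [set x : fbasis k | wt G x = N%:Z]) zmode G B v (deltaB x) x.

(** Z_{V_L^+}(v,tau): trace of o(v) restricted to the weight-N space of the
    fixed-point subspace V_L^+, computed as Tr(o(v) o pi) with
    pi = (1 + theta)/2 the projection of V_L onto V_L^+. *)
Definition ZVLplus k (G : 'M[int]_k) (B : 'M[C]_k) (v : fvec k) : pseries := fun N =>
  \sum_(x \in [set x : fbasis k | wt G x = N%:Z])
     zmode G B v (fun y => (deltaB x y + theta (deltaB x) y) / 2) x.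

Definition inv0 p (A : {set 'I_p}) (s : {perm 'I_p}) : bool :=
  [forall x, if x \in A then (s x != x) && (s (s x) == x) else s x == x].

Definition inv_sum p (A : {set 'I_p}) (w : 'I_p -> 'I_p -> pseries) : pseries :=
  \big[ps_add/ps_zero]_(s : {perm 'I_p} | inv0 A s)
     \big[ps_mul/ps_one]_(r in A | (r < s r)%N) w r (s r).

(* Main.v *)
(** On [M (x) e^be], with [eps = 1] (trace on V_L) or [eps = -1] and [be = 0]
    (trace of the involution), cyclicity
      [Tr(h(-m) A) = eps q^m Tr(A h(-m)),   Tr(A h(m)) = eps q^m Tr(h(m) A)]
    for a normally ordered product [A] of fields shows that the trace [T] of the
    zero mode of a monomial satisfies
      [T(x_e mu) = mean(e) T(mu) + sum_f cov(e, f) T(d mu / dx_f)]: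
    it is a Gaussian functional on the Fock space.  A square-bracket mode h[-n]
    is [sum_j c_j x_j + sum_f d_f d/dx_f], so the functional
    [h[-n_1] ... h[-n_p] 1 |-> T] is again governed by a recursion of this form,
    with new mean and covariance; hence it is given by Wick's formula.  The new
    mean is [(h, be)] if [n = 1] and [0] otherwise; the new covariance is \hat E
    for [eps = 1] and \hat F for [eps = -1], its constant term coming from the
    derivative part of h[-n] and its higher terms from the geometric series
    [eps q^m / (1 - eps q^m)].  The mean vanishes at [be = 0], so only perfect
    matchings of the whole index set survive for the involution.  Summing over
    [be] produces the theta series. *)
Require Import Defs.
From HB Require Import structures.
From mathcomp Require Import all_boot all_order all_algebra perm fingroup.
From mathcomp Require Import finmap multiset.
From mathcomp Require Import boolp classical_sets functions cardinality fsbigop.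
From mathcomp Require Import complex Rstruct.
From mathcomp Require Import ring zify.
Set Implicit Arguments.
Unset Strict Implicit.
Unset Printing Implicit Defensive.
Import Order.TTheory GRing.Theory Num.Theory.
Local Open Scope mset_scope.
Local Open Scope ring_scope.

(** * Formal power series *)

(** A field has infinitely many modes, so the zero mode is an infinite sum. The proof cuts all
    fields off at modes of absolute value at most [K]. For weight reasons this does not change the
    coefficient of q^N when N <= K, while the Gaussian recursion holds exactly for the truncated
    fields; only the covariances are then compared with \hat E and \hat F, modulo q^(K+1). At each
    coefficient N the choice K = N suffices. The arithmetic enters through one identity: the
    creation coefficients of h[-n], weighted by binom(x, j), sum to (x+1)^(n-1)/(n-1)!. At x = -1
    this singles out n = 1, the origin of the set Lambda. At x = m-1 and x = -m-1 it produces the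
    powers m^(n+n'-1) of the divisor sums. With sign -1, the identity (-1)^c = 2 [c even] - 1 turns
    E(tau) into 2 E(2 tau) - E(tau). In the statement, Z_{V_L^+} - Z_{V_L}/2 is half the trace of
    the involution, to which only M (x) e^0 contributes. *)

Definition psring : Type := pseries.

HB.instance Definition _ := gen_eqMixin psring.
HB.instance Definition _ := gen_choiceMixin psring.

Lemma ps_addA : associative (ps_add : psring -> psring -> psring).
Proof. by move=> f g h; apply/funext=> n; rewrite /ps_add addrA. Qed.
Lemma ps_addC : commutative (ps_add : psring -> psring -> psring).
Proof. by move=> f g; apply/funext=> n; rewrite /ps_add addrC. Qed.
Lemma ps_add0 : left_id (ps_zero : psring) ps_add.
Proof. by move=> f; apply/funext=> n; rewrite /ps_add add0r. Qed.
Lemma ps_addN : left_inverse (ps_zero : psring) (ps_scale (-1)) ps_add.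
Proof. by move=> f; apply/funext=> n; rewrite /ps_add /ps_scale mulN1r addNr. Qed.

HB.instance Definition _ :=
  GRing.isZmodule.Build psring ps_addA ps_addC ps_add0 ps_addN.

Definition ps_trunc (N : nat) (f : psring) : {poly C} := \poly_(i < N.+1) f i.

Lemma coef_ps_trunc N f i : (i <= N)%N -> (ps_trunc N f)`_i = f i.
Proof. by move=> le; rewrite coef_poly ltnS le. Qed.

Lemma coef_ps_truncM N (f g : psring) i : (i <= N)%N ->
  (ps_trunc N f * ps_trunc N g)`_i = ps_mul f g i.
Proof.
move=> le; rewrite coefM; apply: eq_bigr => j _.
by rewrite !coef_ps_trunc // (leq_trans _ le) ?leq_subr // -ltnS.
Qed.

Lemma coef_polyM_congr N (p p' r r' : {poly C}) :
  (forall i, (i <= N)%N -> p`_i = p'`_i) -> (forall i, (i <= N)%N -> r`_i = r'`_i) ->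
  forall i, (i <= N)%N -> (p * r)`_i = (p' * r')`_i.
Proof.
move=> Hp Hr i le; rewrite !coefM; apply: eq_bigr => j _.
by rewrite Hp ?Hr // (leq_trans _ le) ?leq_subr // -ltnS.
Qed.

(** A coefficient of a product depends only on coefficients of lower or equal index, so the ring
    laws are inherited from polynomials by truncation. *)
Lemma ps_mulA : associative (ps_mul : psring -> psring -> psring).
Proof.
move=> f g h; apply/funext=> n.
rewrite -!(@coef_ps_truncM n) //.
rewrite (@coef_polyM_congr n _ (ps_trunc n f) _ (ps_trunc n g * ps_trunc n h)) //; last first.
  by move=> i le; rewrite coef_ps_trunc // coef_ps_truncM.
rewrite (@coef_polyM_congr n (ps_trunc n (ps_mul f g))
  (ps_trunc n f * ps_trunc n g) _ (ps_trunc n h)) ?mulrA //.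
by move=> i le; rewrite coef_ps_trunc // coef_ps_truncM.
Qed.
Lemma ps_mulC : commutative (ps_mul : psring -> psring -> psring).
Proof. by move=> f g; apply/funext=> n; rewrite -!(@coef_ps_truncM n) // mulrC. Qed.
Lemma ps_mul1 : left_id (ps_one : psring) ps_mul.
Proof.
move=> f; apply/funext=> n; rewrite /ps_mul big_ord_recl /ps_one eqxx mul1r subn0.
by rewrite big1 ?addr0 // => i _; rewrite mul0r.
Qed.
Lemma ps_mulDl : left_distributive (ps_mul : psring -> psring -> psring) ps_add.
Proof.
move=> f g h; apply/funext=> n; rewrite /ps_mul /ps_add -big_split.
by apply: eq_bigr => i _; rewrite mulrDl.
Qed.
Lemma ps_one_neq0 : (ps_one : psring) != ps_zero.
Proof. by apply/eqP => /(congr1 (fun f => f 0%N)) /eqP; rewrite oner_eq0. Qed.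

HB.instance Definition _ :=
  GRing.Zmodule_isComNzRing.Build psring ps_mulA ps_mulC ps_mul1 ps_mulDl ps_one_neq0.

Lemma psE : ((ps_add = +%R :> (psring -> psring -> psring)) *
  (ps_mul = *%R :> (psring -> psring -> psring)) *
  (ps_zero = 0 :> psring) * (ps_one = 1 :> psring))%type.
Proof. by []. Qed.

Lemma psDE (f g : psring) n : (f + g) n = f n + g n. Proof. by []. Qed.
Lemma psNE (f : psring) n : (- f) n = - f n. Proof. exact: mulN1r (f n). Qed.
Lemma psBE (f g : psring) n : (f - g) n = f n - g n. Proof. by rewrite psDE psNE. Qed.
Lemma ps0E n : (0 : psring) n = 0. Proof. by []. Qed.
Lemma ps1E n : (1 : psring) n = (n == 0%N)%:R. Proof. by []. Qed.
Lemma psME (f g : psring) n : (f * g) n = \sum_(i < n.+1) f i * g (n - i)%N.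
Proof. by []. Qed.

Lemma ps_sumE I (r : seq I) (P : pred I) (F : I -> psring) n :
  (\sum_(i <- r | P i) F i) n = \sum_(i <- r | P i) F i n.
Proof. by apply: (big_morph (fun f : psring => f n)). Qed.

Definition psC (c : C) : psring := fun n => if n == 0%N then c else 0.

Lemma psCME c (f : psring) n : (psC c * f) n = c * f n.
Proof.
rewrite psME big_ord_recl /psC eqxx subn0 big1 ?addr0 // => i _.
by rewrite mul0r.
Qed.
Lemma ps_scaleE c (f : psring) : ps_scale c f = psC c * f :> psring.
Proof. by apply/funext=> n; rewrite psCME. Qed.

Lemma psC_is_zmod : zmod_morphism psC.
Proof. by move=> x y; apply/funext=> n; rewrite psBE /psC; case: eqP => // _; rewrite subr0. Qed.
HB.instance Definition _ := GRing.isZmodMorphism.Build C psring psC psC_is_zmod.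
Lemma psC_is_monoid : monoid_morphism psC.
Proof.
split; first by apply/funext=> n; rewrite /psC ps1E; case: eqP.
by move=> x y; apply/funext=> n; rewrite psCME /psC; case: eqP => // _; rewrite mulr0.
Qed.
HB.instance Definition _ := GRing.isMonoidMorphism.Build C psring psC psC_is_monoid.

Definition psq (m : nat) : psring := fun n => (n == m)%:R.

Lemma psqME m (f : psring) n : (psq m * f) n = if (m <= n)%N then f (n - m)%N else 0.
Proof.
rewrite psME; case: leqP => [le|lt].
  rewrite (bigD1 (Ordinal (le : (m < n.+1)%N))) //= /psq eqxx mul1r big1 ?addr0 //.
  by move=> i; rewrite -val_eqE /= => /negPf ->; rewrite mul0r.
rewrite big1 // => i _; rewrite /psq; case: eqP => [E|_]; last by rewrite mul0r.
by have := ltn_ord i; rewrite E ltnS leqNgt lt.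
Qed.

(** Congruence modulo q^(N+1), the precision to which the truncated covariances are correct. *)
Definition ps_eqmod (N : nat) (f g : psring) : Prop := forall i, (i <= N)%N -> f i = g i.

Lemma ps_eqmod_refl N f : ps_eqmod N f f. Proof. by []. Qed.
Lemma ps_eqmodD N f g f' g' : ps_eqmod N f f' -> ps_eqmod N g g' ->
  ps_eqmod N (f + g) (f' + g').
Proof. by move=> H1 H2 i le; rewrite !psDE H1 ?H2. Qed.
Lemma ps_eqmodM N f g f' g' : ps_eqmod N f f' -> ps_eqmod N g g' ->
  ps_eqmod N (f * g) (f' * g').
Proof.
move=> H1 H2 i le; rewrite !psME; apply: eq_bigr => j _.
by rewrite H1 ?H2 // (leq_trans _ le) ?leq_subr // -ltnS.
Qed.
Lemma ps_eqmod_sum N I (r : seq I) (P : pred I) (F F' : I -> psring) :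
  (forall i, P i -> ps_eqmod N (F i) (F' i)) ->
  ps_eqmod N (\sum_(i <- r | P i) F i) (\sum_(i <- r | P i) F' i).
Proof. by move=> H; elim/big_ind2: _ => // ? ? ? ? ? ?; apply: ps_eqmodD. Qed.
Lemma ps_eqmod_prod N I (r : seq I) (P : pred I) (F F' : I -> psring) :
  (forall i, P i -> ps_eqmod N (F i) (F' i)) ->
  ps_eqmod N (\prod_(i <- r | P i) F i) (\prod_(i <- r | P i) F' i).
Proof. by move=> H; elim/big_ind2: _ => // ? ? ? ? ? ?; apply: ps_eqmodM. Qed.

Lemma size_ps_inv_aux f n : size (ps_inv_aux f n) = n.+1.
Proof. by elim: n => //= n IH; rewrite size_rcons IH. Qed.

Lemma nth_ps_inv_aux f n m : (m <= n)%N -> nth 0 (ps_inv_aux f n) m = ps_inv f m.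
Proof.
elim: n => [|n IH]; first by rewrite leqn0 => /eqP->.
rewrite leq_eqVlt => /orP[/eqP->//|lt].
by rewrite /= nth_rcons size_ps_inv_aux lt IH.
Qed.

Lemma mulps_inv (f : psring) : f 0%N != 0 -> f * (ps_inv f : psring) = 1.
Proof.
move=> f0; apply/funext => -[|n].
  by rewrite psME big_ord1 /ps_inv /= divff.
rewrite psME big_ord_recl subn0 {1}/ps_inv /= nth_rcons size_ps_inv_aux ltnn eqxx.
rewrite mulrA mulrN divff // mulN1r ps1E /=; apply/eqP; rewrite addrC subr_eq0; apply/eqP.
apply: eq_bigr => i _; rewrite /bump /= add1n subSS nth_ps_inv_aux // ?leq_subr //.
Qed.

Lemma ps_ipow_pos (f : psring) (m : nat) : ps_ipow f m%:Z = f ^+ m :> psring.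
Proof. by rewrite /ps_ipow; elim: m => //= m ->; rewrite exprS. Qed.

Lemma ps_ipow_neg (f : psring) (m : nat) : ps_ipow f (- m%:Z) = (ps_inv f : psring) ^+ m :> psring.
Proof.
case: m => [|m]; first by rewrite oppr0.
rewrite -NegzE /ps_ipow; elim: m => [|m IH]; last by rewrite [RHS]exprS iterS IH.
by rewrite expr1; exact: (mulr1 (ps_inv f : psring)).
Qed.

Lemma ps_mulr_inj (u v f g : psring) : u * v = 1 -> u * f = u * g -> f = g.
Proof.
by move=> uv /(congr1 ( *%R v)); rewrite !mulrA ![v * u]mulrC uv !mul1r.
Qed.

(** The Euler operator z d/dz: a derivation that, unlike d/dz, shifts no index, and whose kernel
    consists of the constants. *)
Definition ps_euler (f : psring) : psring := fun n => n%:R * f n.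

Lemma ps_eulerM (f g : psring) : ps_euler (f * g) = ps_euler f * g + f * ps_euler g.
Proof.
apply/funext=> n; rewrite /ps_euler psDE !psME mulr_sumr -big_split.
apply: eq_bigr => i _ /=.
have -> : n%:R = i%:R + (n - i)%:R :> C by rewrite -natrD subnKC // -ltnS.
by ring.
Qed.

(** * Square-bracket coefficients *)

Lemma natC_neq0 n : (n.+1%:R : C) != 0. Proof. by rewrite pnatr_eq0. Qed.
Lemma factC_neq0 n : (n`!%:R : C) != 0.
Proof. by rewrite pnatr_eq0 -lt0n fact_gt0. Qed.

Definition psexp : psring := ps_exp.
Definition psg : psring := ps_g.
Definition psginv : psring := ps_inv ps_g.

Lemma psg_mulV : psg * psginv = 1.
Proof. by apply: mulps_inv; rewrite /ps_g invr_eq0; exact: factC_neq0 1. Qed.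

Lemma ps_euler_exp : ps_euler psexp = psq 1 * psexp.
Proof.
apply/funext=> -[|n]; rewrite psqME /ps_euler /psexp /ps_exp /=; first by rewrite mul0r.
rewrite subSS subn0 factS natrM invfM mulrA divff ?mul1r //; exact: natC_neq0.
Qed.

Lemma psexpE : psexp = 1 + psq 1 * psg.
Proof.
apply/funext=> -[|n]; rewrite psDE psqME ps1E /= ?addr0 ?add0r /psexp /ps_exp ?fact0 ?invr1 //.
by rewrite /psg /ps_g subSS subn0.
Qed.

Lemma ps_euler_g : ps_euler psg = psexp - psg.
Proof.
apply/funext=> n; rewrite psBE /ps_euler /psexp /psg /ps_g /ps_exp factS natrM invfM.
by field; rewrite factC_neq0 ?nat1r ?natr1 natC_neq0.
Qed.

Lemma ps_euler1 : ps_euler 1 = 0.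
Proof. by apply/funext=> -[|n]; rewrite /ps_euler ps1E ?mul0r ?mulr0. Qed.

(** Apply the derivation to g * g^-1 = 1. *)
Lemma ps_euler_ginv : ps_euler psginv = psginv - psexp * psginv ^+ 2.
Proof.
have := congr1 ps_euler psg_mulV; rewrite ps_eulerM ps_euler1 ps_euler_g => E.
apply: (ps_mulr_inj psg_mulV).
have -> : psg * ps_euler psginv = - ((psexp - psg) * psginv).
  by apply/eqP; rewrite -subr_eq0 opprK addrC E.
have -> : psg * (psginv - psexp * psginv ^+ 2) =
   (psg * psginv) * (1 - psexp * psginv) by ring.
by rewrite mulrBl psg_mulV; ring.
Qed.

Definition psg_zpow (j : int) : psring := ps_ipow ps_g j.

Lemma psg_zpowS (j : int) : psg_zpow (j + 1) = psg * psg_zpow j.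
Proof.
rewrite /psg_zpow; case: j => j.
  have -> : Posz j + 1 = j.+1%:Z by lia.
  by rewrite !ps_ipow_pos exprS.
rewrite NegzE; have -> : - j.+1%:Z + 1 = - j%:Z by lia.
by rewrite !ps_ipow_neg exprS mulrA psg_mulV mul1r.
Qed.

Lemma ps_eulerX (f : psring) n : ps_euler (f ^+ n.+1) = n.+1%:R * f ^+ n * ps_euler f.
Proof.
elim: n => [|n IH]; first by rewrite expr1 expr0 !mul1r.
rewrite [in LHS]exprS ps_eulerM IH -[n.+2%:R]natr1 [f ^+ n.+1]exprS.
by move: (f ^+ n) (ps_euler f) => u v; ring.
Qed.

Lemma ps_euler_zpow (j : int) :
  ps_euler (psg_zpow (j + 1)) = (j + 1)%:~R * psg_zpow j * (psexp - psg).
Proof.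
rewrite /psg_zpow; case: j => j.
  have -> : Posz j + 1 = j.+1%:Z by lia.
  by rewrite !ps_ipow_pos ps_eulerX ps_euler_g.
rewrite NegzE; have -> : - j.+1%:Z + 1 = - j%:Z by lia.
rewrite !ps_ipow_neg; case: j => [|j].
  by rewrite expr0 ps_euler1 oppr0 mulr0z !mul0r.
rewrite ps_eulerX -/psginv ps_euler_ginv mulrNz.
have -> : psginv - psexp * psginv ^+ 2 = psg * psginv * psginv - psexp * psginv ^+ 2.
  by rewrite psg_mulV mul1r.
rewrite -[j.+1%:~R]/(j.+1%:R) !exprS expr0.
by move: (psginv ^+ j) (j.+1%:R) => u v; ring.
Qed.

(* [sbcoef n m] is the coefficient of [z^(m - n)] in this series. *)
Definition sbgen (m : int) : psring := psexp * psg_zpow (- m - 1).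

(** Put phi_m = e^z (e^z - 1)^(-m-1) = z^(-m-1) [sbgen m]. Writing e^z = 1 + (e^z - 1) gives phi_m'
    = - m phi_m - (m+1) phi_(m+1); this is that equation multiplied by z^(m+2). *)
Lemma ps_euler_sbgen m :
  ps_euler (sbgen m) - (m + 1)%:~R * sbgen m =
  - (m%:~R * (psq 1 * sbgen m)) - (m + 1)%:~R * sbgen (m + 1).
Proof.
(* With m = -j-2 the powers of g that occur are j+1 and j, as in [ps_euler_zpow]. *)
have [j ->] : exists j : int, m = - j - 2 by exists (- m - 2); lia.
rewrite /sbgen; have -> : - (- j - 2) - 1 = j + 1 by lia.
have -> : - (- j - 2 + 1) - 1 = j by lia.
rewrite ps_eulerM ps_euler_zpow ps_euler_exp psg_zpowS.
rewrite !rmorphD /= !rmorphN /= !rmorph1; have -> : (2%:~R : psring) = 1 + 1 by [].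
rewrite psexpE; move: (psg_zpow j) (psq 1) psg (j%:~R) => Z q g J; ring.
Qed.

Lemma intr_psME (j : int) (f : psring) n : (j%:~R * f) n = j%:~R * f n.
Proof. by rewrite -[j%:~R]/(1 *~ j) -(rmorph_int psC) psCME. Qed.

(** Compares the coefficients of z^(n-1) in phi_m' = - m phi_m - (m+1) phi_(m+1). It lets every fact
    about h[-n] be proved by induction on n. *)
Lemma sbcoef_rec (n : nat) (m : int) :
  n%:R * sbcoef (- n.+1%:Z) m =
  - m%:~R * sbcoef (- n%:Z) m - (m + 1)%:~R * sbcoef (- n%:Z) (m + 1).
Proof.
have K l : l%:R * sbgen m l - (m + 1)%:~R * sbgen m l =
    - (m%:~R * (psq 1 * sbgen m) l) - (m + 1)%:~R * sbgen (m + 1) l.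
  have := congr1 (fun f : psring => f l) (ps_euler_sbgen m).
  by rewrite !psBE psNE !intr_psME.
rewrite /sbcoef -/psexp -!/(psg_zpow _) psE -!/(sbgen _).
(* Below, at and above the leading exponent, where the default value 0 of [sbcoef] has to be treated
   separately. *)
have [lt|] := ltP (m + n%:Z) (-1).
  by do ![case: ifP => ?; first by exfalso; lia]; rewrite !mulr0 subr0.
rewrite le_eqVlt => /orP[/eqP E|lt].
  have -> : (- n%:Z <= m) = false by lia.
  have -> : (- n.+1%:Z <= m) = true by lia.
  have -> : (- n%:Z <= m + 1) = true by lia.
  have -> : `|(m - - n.+1%:Z)%R|%N = 0%N by lia.
  have -> : `|(m + 1 - - n%:Z)%R|%N = 0%N by lia.
  have := K 0%N; rewrite psqME /= mul0r !mulr0 oppr0 !sub0r => <-.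
  have -> : m + 1 = - n%:Z by lia.
  by rewrite rmorphN /= mulNr opprK -pmulrn.
have -> : (- n%:Z <= m) = true by lia.
have -> : (- n.+1%:Z <= m) = true by lia.
have -> : (- n%:Z <= m + 1) = true by lia.
have [l El] : exists l : nat, m = l%:Z - n%:Z by exists (absz (m + n%:Z)); lia.
have -> : `|(m - - n.+1%:Z)%R|%N = l.+1 by lia.
have -> : `|(m - - n%:Z)%R|%N = l by lia.
have -> : `|(m + 1 - - n%:Z)%R|%N = l.+1 by lia.
have := K l.+1; rewrite psqME /= subSS subn0 => {}K.
rewrite !mulNr -K -mulrBl; congr (_ * _).
have -> : m + 1 = l.+1%:Z - n%:Z by lia.
by rewrite rmorphB /= -!pmulrn opprB addrCA subrr addr0.
Qed.

(** [sbneg n j] and [sbpos n m] are the coefficients of h(-(j+1)) and h(m+1) in h[-n]. The former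
    are the c_j of the overview, the latter its d_f up to the commutator factor m+1. *)
Definition sbneg (n j : nat) : C := sbcoef (- n%:Z) (Negz j).
Definition sbpos (n m : nat) : C := sbcoef (- n%:Z) m.+1.

Lemma sbneg_ge n j : (n <= j)%N -> sbneg n j = 0.
Proof. by move=> le; rewrite /sbneg /sbcoef NegzE ifF //; apply/negbTE; lia. Qed.

Lemma sbneg_rec0 n : n%:R * sbneg n.+1 0 = sbneg n 0.
Proof.
rewrite /sbneg sbcoef_rec; have -> : Negz 0 + 1 = 0 by [].
by rewrite mul0r subr0 NegzE /= opprK mul1r.
Qed.

Lemma sbneg_recS n j :
  n%:R * sbneg n.+1 j.+1 = j.+2%:R * sbneg n j.+1 + j.+1%:R * sbneg n j.
Proof.
rewrite /sbneg sbcoef_rec; have -> : Negz j.+1 + 1 = Negz j by rewrite !NegzE; lia.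
by rewrite !NegzE !rmorphN /= !opprK mulNr opprK -!pmulrn.
Qed.

Lemma sbpos_rec n m :
  n%:R * sbpos n.+1 m = - (m.+1%:R * sbpos n m) - m.+2%:R * sbpos n m.+1.
Proof.
rewrite /sbpos sbcoef_rec; have -> : m.+1%:Z + 1 = m.+2%:Z by lia.
by rewrite -!pmulrn mulNr.
Qed.

Lemma sbneg10 : sbneg 1 0 = 1.
Proof.
rewrite /sbneg /sbcoef /= /ps_mul big_ord1 /ps_exp /= fact0 invr1 mul1r.
by rewrite /ps_ipow /= /ps_one eqxx.
Qed.

(** The coefficient of h(1) comes from e^z (e^z - 1)^-2 = - d/dz (e^z - 1)^-1; this is where the
    Bernoulli numbers enter. *)
Lemma sbpos0 n : sbpos n 0 = - n%:R * psginv n.+1.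
Proof.
rewrite /sbpos /sbcoef ifT; last by lia.
have -> : `|(1%:Z - - n%:Z)%R|%N = n.+1 by lia.
have -> : - 1%:Z - 1 = - 2%:Z by lia.
rewrite -/psexp ps_ipow_neg -/psginv psE.
have := congr1 (fun f : psring => f n.+1) ps_euler_ginv.
rewrite psBE /ps_euler -[n.+1%:R]natr1 => E.
have -> : (psexp * psginv ^+ 2) n.+1 = psginv n.+1 - (n%:R + 1) * psginv n.+1.
  by rewrite E; ring.
by ring.
Qed.

Lemma gbinom0 x : gbinom x 0 = 1.
Proof. by rewrite /gbinom big_ord0 fact0 invr1 mulr1. Qed.

Lemma gbinomS x j : j.+1%:R * gbinom x j.+1 = (x - j%:Z)%:~R * gbinom x j.
Proof.
rewrite /gbinom big_ord_recr /= factS natrM.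
by field; rewrite factC_neq0 ?nat1r ?natr1 natC_neq0.
Qed.

(* Coefficientwise form of
   [sum_j (e^z - 1)^j binom(x, j) e^z = e^((x + 1) z)]. *)
Lemma sbneg_gbinom n x :
  \sum_(j < n.+1) sbneg n.+1 j * gbinom x j = (x + 1)%:~R ^+ n / n`!%:R.
Proof.
elim: n => [|n IH].
  by rewrite big_ord1 sbneg10 gbinom0 expr0 fact0 divr1 mulr1.
apply: (mulfI (natC_neq0 n)).
have -> : n.+1%:R * ((x + 1)%:~R ^+ n.+1 / (n.+1)`!%:R) =
    (x + 1)%:~R * ((x + 1)%:~R ^+ n / n`!%:R) :> C.
  rewrite factS natrM exprS.
  by field; rewrite factC_neq0 ?nat1r ?natr1 natC_neq0.
rewrite -IH mulr_sumr big_ord_recl /= mulrA sbneg_rec0.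
under eq_bigr => i _ do rewrite mulrA sbneg_recS mulrDl.
rewrite big_split /= addrA.
have -> : sbneg n.+1 0 * gbinom x 0 +
   \sum_(i < n.+1) i.+2%:R * sbneg n.+1 i.+1 * gbinom x i.+1 =
   \sum_(i < n.+1) i.+1%:R * sbneg n.+1 i * gbinom x i.
  rewrite [RHS]big_ord_recl big_ord_recr /= (@sbneg_ge n.+1 n.+1) // mulr0 mul0r addr0 mul1r.
  by congr (_ + _); apply: eq_bigr.
rewrite mulr_sumr -big_split; apply: eq_bigr => i _ /=.
have := gbinomS x i => E.
have -> : i.+1%:R * sbneg n.+1 i * gbinom x i.+1 =
  sbneg n.+1 i * (i.+1%:R * gbinom x i.+1) by ring.
rewrite E !rmorphD rmorphN rmorph1 /= -[i.+1%:R]natr1 -pmulrn; by ring.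
Qed.

(** The contraction of the annihilation part of h[-n] with the creation part of h[-n'], which will
    be the constant term of the covariance. *)
Definition sbpair (n n' : nat) : C :=
  \sum_(l < n') sbpos n l * l.+1%:R * sbneg n' l.

(** Translation invariance: the generating series of [sbpair n n'] in z^(n-1) w^(n'-1) is killed by
    d/dz + d/dw. The proof is a summation by parts with the recursions for [sbneg] and [sbpos]. *)
Lemma sbpair_rec n n' : n%:R * sbpair n.+1 n' + n'%:R * sbpair n n'.+1 = 0.
Proof.
rewrite /sbpair !mulr_sumr big_ord_recl /=.
have -> : n'%:R * (sbpos n 0 * 1 * sbneg n'.+1 0) = sbpos n 0 * sbneg n' 0.
  by rewrite -(sbneg_rec0 n'); ring.
have -> : \sum_(i < n') n'%:R *
    (sbpos n (bump 0 i) * (bump 0 i).+1%:R * sbneg n'.+1 (bump 0 i)) =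
  \sum_(i < n') sbpos n i.+1 * i.+2%:R * (i.+2%:R * sbneg n' i.+1) +
  \sum_(i < n') sbpos n i.+1 * i.+2%:R * (i.+1%:R * sbneg n' i).
  rewrite -big_split; apply: eq_bigr => i _ /=; rewrite /bump /= add1n.
  by rewrite -mulrDr -sbneg_recS; ring.
have -> : sbpos n 0 * sbneg n' 0 +
  (\sum_(i < n') sbpos n i.+1 * i.+2%:R * (i.+2%:R * sbneg n' i.+1) +
   \sum_(i < n') sbpos n i.+1 * i.+2%:R * (i.+1%:R * sbneg n' i)) =
  \sum_(i < n') sbpos n i * i.+1%:R * (i.+1%:R * sbneg n' i) +
  \sum_(i < n') sbpos n i.+1 * i.+2%:R * (i.+1%:R * sbneg n' i).
  rewrite addrA; congr (_ + _).
  case: n' => [|n']; first by rewrite !big_ord0 addr0 sbneg_ge // mulr0.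
  rewrite [RHS]big_ord_recl big_ord_recr /= (@sbneg_ge n'.+1 n'.+1) // !mulr0 addr0 mulr1 mul1r.
  by congr (_ + _); apply: eq_bigr.
rewrite -!big_split big1 //= => i _.
have -> : n%:R * (sbpos n.+1 i * i.+1%:R * sbneg n' i) =
  (n%:R * sbpos n.+1 i) * i.+1%:R * sbneg n' i by ring.
by rewrite sbpos_rec; ring.
Qed.

(** Translation invariance trades n' for n with n + n' fixed, until n' = 1, where only the
    coefficient of h(1) is left. The binomial in [hatc] collects the factors of this descent. *)
Lemma sbpairE n n' : (0 < n)%N -> (0 < n')%N ->
  sbpair n n' = hatc n n' * - psginv (n + n')%N.
Proof.
move=> n0; case: n' => // n' _; elim: n' n n0 => [|n' IH] n n0.
  rewrite /sbpair big_ord1 sbneg10 sbpos0 /hatc addn1 subn1 /= bin1 mul1n.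
  by rewrite expr2; ring.
apply: (mulfI (natC_neq0 n')).
have /eqP := sbpair_rec n n'.+1; rewrite addr_eq0 => /eqP E.
have -> : n'.+1%:R * sbpair n n'.+2 = - (n%:R * sbpair n.+1 n'.+1) by rewrite E opprK.
rewrite IH // /hatc addSnnS.
have := mul_bin_left (n + n'.+2 - 1) n'.+1.
have -> : (n + n'.+2 - 1 - n'.+1 = n)%N by lia.
by move=> ->; rewrite [in RHS]exprS !natrM; ring.
Qed.

Definition ps_flip (f : psring) : psring := fun n => (-1) ^+ n * f n.

Lemma ps_flipM (f g : psring) : ps_flip (f * g) = ps_flip f * ps_flip g.
Proof.
apply/funext=> n; rewrite /ps_flip !psME mulr_sumr; apply: eq_bigr => i _.
have -> : (-1) ^+ n = (-1) ^+ i * (-1) ^+ (n - i) :> C.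
  by rewrite -exprD subnKC // -ltnS.
by ring.
Qed.

(** The substitution z -> -z turns z/(e^z - 1) into z/(e^z - 1) + z. *)
Lemma psginv_odd n : odd n -> n != 1%N -> psginv n = 0.
Proof.
move=> on n1.
pose en := ps_flip psexp; pose gn := ps_flip psg.
have fq : ps_flip (psq 1) = - psq 1.
  apply/funext=> m; rewrite psNE /ps_flip /psq; case: eqP => [->|_]; last by rewrite mulr0 oppr0.
  by rewrite expr1 mulr1.
have f1 : ps_flip 1 = 1.
  by apply/funext=> -[|m]; rewrite /ps_flip ps1E ?mulr0 // mul1r.
have fe (f : psring) : ps_euler (ps_flip f) = ps_flip (ps_euler f).
  by apply/funext=> m; rewrite /ps_euler /ps_flip mulrCA.
have enE : en = 1 - psq 1 * gn.
  rewrite /en {1}psexpE -mulNr -fq -ps_flipM -[in RHS]f1.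
  by apply/funext=> m; rewrite /ps_flip !psDE mulrDr.
(* e^z e^(-z) has Euler derivative 0, so it equals its constant term. *)
have ee : psexp * en = 1.
  have : ps_euler (psexp * en) = 0.
    by rewrite ps_eulerM fe ps_euler_exp ps_flipM fq -/en; ring.
  move=> /(congr1 (fun f : psring => f _)) E; apply/funext=> -[|m].
    by rewrite psME big_ord1 /en /ps_flip /psexp /ps_exp /= fact0 invr1 !mul1r.
  have := E m.+1; rewrite /ps_euler ps0E => /eqP.
  by rewrite mulf_eq0 (negPf (natC_neq0 m)) /= ps1E => /eqP.
(* e^z (1 - e^(-z)) = e^z - 1, divided by z. *)
have eg : psexp * gn = psg.
  have : psq 1 * (psexp * gn) = psq 1 * psg.
    have : psexp - 1 = psq 1 * (psexp * gn).
      by rewrite -[X in psexp - X]ee enE; ring.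
    by move=> <-; rewrite {1}psexpE addrC addKr.
  move=> /(congr1 (fun f : psring => f _)) E; apply/funext=> m.
  by have := E m.+1; rewrite !psqME /= subSS subn0.
have : ps_flip psginv = psginv + psq 1.
  apply: (ps_mulr_inj psg_mulV); rewrite -{1}eg -mulrA -ps_flipM psg_mulV f1.
  by rewrite mulr1 mulrDr psg_mulV mulrC -psexpE.
move=> /(congr1 (fun f : psring => f n)).
rewrite psDE /ps_flip /psq (negPf n1) addr0 -signr_odd on expr1 mulN1r => /eqP.
by rewrite eq_sym -subr_eq0 opprK -mulr2n mulrn_eq0 /= => /eqP.
Qed.

(** * Wick's theorem *)

Section Derivation.
Variables (R : comNzRingType) (E : Type).
Implicit Types (w : E -> R) (F : seq E -> R) (s : seq E).

(* Transpose of the derivation [sum_e w e * d/dx_e], acting on functionals on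
   monomials, the latter being written as lists of variables. *)
Fixpoint der_tr w F s : R :=
  if s is e :: s' then w e * F s' + der_tr w (fun t => F (e :: t)) s' else 0.

Lemma eq_der_tr w w' F F' s : w =1 w' -> F =1 F' -> der_tr w F s = der_tr w' F' s.
Proof.
move=> Hw HF; elim: s F F' HF => //= e s IH F F' HF.
by rewrite Hw HF (IH _ (fun t => F' (e :: t))).
Qed.

Lemma der_trD w F F' s :
  der_tr w (fun t => F t + F' t) s = der_tr w F s + der_tr w F' s.
Proof.
elim: s F F' => [|e s IH] F F' /=; first by rewrite addr0.
by rewrite IH; ring.
Qed.

Lemma der_trZ w c F s : der_tr w (fun t => c * F t) s = c * der_tr w F s.
Proof.
elim: s F => [|e s IH] F /=; first by rewrite mulr0.
by rewrite IH; ring.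
Qed.

Lemma der_tr_sum w I (r : seq I) (c : I -> R) (F : I -> seq E -> R) s :
  der_tr w (fun t => \sum_(i <- r) c i * F i t) s =
  \sum_(i <- r) c i * der_tr w (F i) s.
Proof.
elim: r => [|i r IH].
  rewrite big_nil -[RHS](mul0r (der_tr w (fun=> 0) s)) -der_trZ.
  by apply: eq_der_tr => // t; rewrite big_nil mul0r.
rewrite big_cons -IH -der_trZ -der_trD; apply: eq_der_tr => // t.
by rewrite big_cons.
Qed.

Lemma der_tr_wD w w' F s :
  der_tr (fun e => w e + w' e) F s = der_tr w F s + der_tr w' F s.
Proof.
elim: s F => [|e s IH] F /=; first by rewrite addr0.
by rewrite IH; ring.
Qed.

Lemma der_tr_wZ w c F s : der_tr (fun e => c * w e) F s = c * der_tr w F s.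
Proof.
elim: s F => [|e s IH] F /=; first by rewrite mulr0.
by rewrite IH; ring.
Qed.

Lemma der_tr_w_sum I (r : seq I) (c : I -> R) (w : I -> E -> R) F s :
  der_tr (fun e => \sum_(i <- r) c i * w i e) F s =
  \sum_(i <- r) c i * der_tr (w i) F s.
Proof.
elim: r => [|i r IH].
  rewrite big_nil -[RHS](mul0r (der_tr (fun=> 0) F s)) -der_tr_wZ.
  by apply: eq_der_tr => // t; rewrite big_nil mul0r.
rewrite big_cons -IH -der_tr_wZ -der_tr_wD; apply: eq_der_tr => // t.
by rewrite big_cons.
Qed.

Lemma der_trC w w' F s : der_tr w (der_tr w' F) s = der_tr w' (der_tr w F) s.
Proof.
elim: s F => //= e s IH F.
by rewrite !der_trD !der_trZ IH addrCA.
Qed.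

End Derivation.

Lemma der_tr_map (R : comNzRingType) (E E' : Type) (f : E' -> E)
    (w : E -> R) (F : seq E -> R) (s : seq E') :
  der_tr w F (map f s) = der_tr (fun e => w (f e)) (fun t => F (map f t)) s.
Proof. by elim: s F => //= e s IH F; rewrite IH. Qed.

(** [der_tr] deletes every occurrence at its own position, [rem] always the first one; permutation
    invariance of [F] reconciles them. *)
Lemma der_tr_perm (R : comNzRingType) (E : eqType) (w : E -> R) (F : seq E -> R) s :
  (forall t t', perm_eq t t' -> F t = F t') ->
  der_tr w F s = \sum_(e <- s) w e * F (rem e s).
Proof.
elim: s F => [|e s IH] F HF; first by rewrite big_nil.
rewrite /= big_cons /= eqxx IH; last by move=> t t' H; apply: HF; rewrite perm_cons.
congr (_ + _); rewrite !big_seq; apply: eq_bigr => f fs.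
congr (_ * _); apply: HF; case: eqP => [->|_] //.
by rewrite perm_sym perm_to_rem.
Qed.

Lemma der_tr_uniq (R : comNzRingType) (E : eqType) (w : E -> R) (F : seq E -> R) s :
  uniq s -> der_tr w F s = \sum_(e <- s) w e * F (rem e s).
Proof.
elim: s F => [|e s IH] F; first by rewrite big_nil.
move=> /= /andP[es us]; rewrite big_cons /= eqxx IH //.
congr (_ + _); rewrite !big_seq; apply: eq_bigr => f fs.
by case: eqP => // E0; rewrite E0 fs in es.
Qed.

(** * Transport of a Gaussian recursion from Fock variables to words in square-bracket modes *)

Section ChangeOfVariables.
Variables (R : comNzRingType) (K : Type) (cc : nat -> nat -> R)
  (dd : K * nat -> K * nat -> R).
Implicit Types (F T : seq (K * nat) -> R) (s : seq (K * nat)).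

(* Transpose of the operator
   [sum_(j < n) cc n j * x_(a, j) + sum_e dd (a, n) e * d/dx_e]. *)
Definition mode_tr (an : K * nat) F s : R :=
  \sum_(j < an.2) cc an.2 j * F ((an.1, j : nat) :: s) + der_tr (dd an) F s.

(* The functional [F] evaluated at the state obtained from [1] by applying the
   operators of [mode_tr], the head of the list being applied last. *)
Fixpoint state_eval s F : R :=
  if s is an :: s' then state_eval s' (mode_tr an F) else F [::].

Lemma eq_state_eval s F F' : F =1 F' -> state_eval s F = state_eval s F'.
Proof.
elim: s F F' => /= [|an s IH] F F' H //; apply: IH => t; rewrite /mode_tr.
by congr (_ + _); [apply: eq_bigr => j _; rewrite H|apply: eq_der_tr].
Qed.

Lemma state_evalD s F F' :
  state_eval s (fun t => F t + F' t) = state_eval s F + state_eval s F'.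
Proof.
elim: s F F' => //= an s IH F F'; rewrite -IH; apply: eq_state_eval => t.
rewrite /mode_tr der_trD addrACA -big_split; congr (_ + _).
by apply: eq_bigr => j _; rewrite mulrDr.
Qed.

Lemma state_evalZ s c F : state_eval s (fun t => c * F t) = c * state_eval s F.
Proof.
elim: s F => //= an s IH F; rewrite -IH; apply: eq_state_eval => t.
rewrite /mode_tr der_trZ mulrDr mulr_sumr; congr (_ + _).
by apply: eq_bigr => j _; rewrite mulrCA.
Qed.

(** A derivation commutes with the derivative part of each mode and has a scalar commutator with its
    multiplication part. Moved through the word until it kills 1, it removes one letter at a
    time. *)
Lemma state_eval_der_tr w F s :
  state_eval s (der_tr w F) =
  der_tr (fun bn => \sum_(j < bn.2) cc bn.2 j * w (bn.1, j : nat))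
         (fun t => state_eval t F) s.
Proof.
elim: s F => //= bn s IH F; set W := \sum_(j < _) _.
have E t : mode_tr bn (der_tr w F) t = W * F t + der_tr w (mode_tr bn F) t.
  rewrite /mode_tr der_trD der_tr_sum der_trC addrA; congr (_ + _).
  rewrite mulr_suml -big_split; apply: eq_bigr => j _ /=; ring.
by rewrite (eq_state_eval _ E) state_evalD state_evalZ IH.
Qed.

(** The head [an] is applied last, so its transpose meets [T] first and the recursion of [T] applies
    to each variable it creates. The resulting derivation, together with the derivative part of
    [an], is then carried to the other letters. *)
Lemma state_eval_rec (z : K * nat -> R) (t : K * nat -> K * nat -> R) T :
  (forall e s, T (e :: s) = z e * T s + der_tr (t e) T s) ->
  forall an s, state_eval (an :: s) T =
    (\sum_(j < an.2) cc an.2 j * z (an.1, j : nat)) * state_eval s T +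
    der_tr (fun bn => \sum_(l < bn.2) cc bn.2 l *
                (\sum_(j < an.2) cc an.2 j * t (an.1, j : nat) (bn.1, l : nat)
                 + dd an (bn.1, l : nat)))
      (fun s' => state_eval s' T) s.
Proof.
move=> HT an s; rewrite -(state_eval_der_tr (fun e =>
  \sum_(j < an.2) cc an.2 j * t (an.1, j : nat) e + dd an e)) -state_evalZ -state_evalD /=.
apply: eq_state_eval => s'; rewrite /mode_tr der_tr_wD der_tr_w_sum addrA; congr (_ + _).
rewrite mulr_suml -big_split; apply: eq_bigr => j _ /=.
by rewrite HT mulrDr mulrA.
Qed.

End ChangeOfVariables.

(** * Sums over fixed-point-free involutions and Wick's formula *)

Section Involutions.
Variables (R : comNzRingType) (p : nat).
Implicit Types (A D : {set 'I_p}) (w : 'I_p -> 'I_p -> R) (z : 'I_p -> R).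

Definition pairings A w : R :=
  \sum_(s : {perm 'I_p} | Defs.inv0 A s) \prod_(r in A | (r < s r)%N) w r (s r).

Lemma inv0P A (s : {perm 'I_p}) :
  reflect (forall x, (x \in A -> s x != x /\ s (s x) = x) /\ (x \notin A -> s x = x))
          (Defs.inv0 A s).
Proof.
apply: (iffP forallP) => H x; have := H x; case: (x \in A).
- by move=> /andP[-> /eqP ->].
- by move=> /eqP ->.
- by move=> [/(_ isT)[-> ->] _]; rewrite eqxx.
- by move=> [_ /(_ isT) ->].
Qed.

Lemma pairings0 w : pairings finset.set0 w = 1.
Proof.
rewrite /pairings (big_pred1 (1%g : {perm 'I_p})) => [|s].
  by rewrite big1 // => r; rewrite inE.
apply/inv0P/eqP => [H|-> x]; last by rewrite perm1 inE.
by apply/permP => x; rewrite perm1; apply: (proj2 (H x)); rewrite inE.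
Qed.

(** Involutions of [A] exchanging r and x correspond to involutions of the remaining points, by
    multiplication with the transposition. *)
Lemma inv0_tperm A r x (s : {perm 'I_p}) : r \in A -> x \in A :\ r ->
  Defs.inv0 A (tperm r x * s)%g && ((tperm r x * s)%g r == x) =
  Defs.inv0 (A :\ r :\ x) s.
Proof.
move=> rA; rewrite finset.in_setD1 => /andP[xr xA].
apply/andP/inv0P => [[/inv0P H /eqP E]|H].
  rewrite permM tpermL in E.
  have E' : s r = r.
    have [_ H2] := proj1 (H r) rA.
    by move: H2; rewrite !permM tpermL E tpermR.
  move=> y; rewrite !finset.in_setD1; have [->|yx] /= := eqVneq y x.
    by split=> // _; exact: E.
  have [->|yr] /= := eqVneq y r; first by split.
  have := H y; rewrite !permM tpermD //; try by rewrite eq_sym.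
  case: (boolP (y \in A)) => yA; last first.
    by move=> [_ /(_ isT) ->].
  move=> [/(_ isT)[h1 h2] _]; split=> // _; split=> //.
  move: h2; rewrite tpermD // eq_sym.
    by rewrite -E' (inj_eq perm_inj).
  by rewrite -E (inj_eq perm_inj).
have E : s x = x by apply: (proj2 (H x)); rewrite !inE eqxx.
have E' : s r = r by apply: (proj2 (H r)); rewrite !inE eqxx andbF.
split; last by rewrite permM tpermL E.
apply/inv0P => y; have [->|yx] /= := eqVneq y x.
  split; last by rewrite xA.
  by move=> _; rewrite !permM tpermR E' tpermL E eq_sym.
have [->|yr] /= := eqVneq y r.
  split; last by rewrite rA.
  by move=> _; rewrite !permM tpermL E tpermR E'.
rewrite !permM (tpermD) //; try by rewrite eq_sym.
rewrite tpermD; first 1 last.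
- by rewrite eq_sym -E' (inj_eq perm_inj).
- by rewrite eq_sym -E (inj_eq perm_inj).
by have := H y; rewrite !finset.in_setD1 yx yr.
Qed.

(** Sort the involutions by the partner of r. Minimality of r makes its transposition appear in the
    product as [w r x], never as [w x r], so [w] need not be symmetric. *)
Lemma pairings_rec A w r : r \in A -> (forall x, x \in A -> (r <= x)%N) ->
  pairings A w = \sum_(x in A :\ r) w r x * pairings (A :\ r :\ x) w.
Proof.
move=> rA rmin; rewrite /pairings.
rewrite (partition_big (fun s : {perm 'I_p} => s r) (mem (A :\ r))) /=; last first.
  move=> s /inv0P H; have [h1 h2] := proj1 (H r) rA.
  rewrite finset.in_setD1 h1 /=; apply/negPn/negP => srA.
  by have := proj2 (H (s r)) srA; rewrite h2 => h; rewrite -h eqxx in h1.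
apply: eq_bigr => x xAr; have := xAr; rewrite finset.in_setD1 => /andP[xr xA].
have ltrx : (r < x)%N.
  by rewrite ltn_neqAle rmin // andbT eq_sym; apply: contraNneq xr => /val_inj ->.
rewrite (reindex_onto (fun s => tperm r x * s)%g (fun s => tperm r x * s)%g) /=; last first.
  by move=> s _; rewrite mulgA tperm2 mul1g.
rewrite mulr_sumr; apply: eq_big => [s|s].
  by rewrite inv0_tperm // mulgA tperm2 mul1g eqxx andbT.
rewrite inv0_tperm // mulgA tperm2 mul1g eqxx andbT => /inv0P H.
have E : s x = x by apply: (proj2 (H x)); rewrite !inE eqxx.
have E' : s r = r by apply: (proj2 (H r)); rewrite !inE eqxx andbF.
rewrite (bigD1 r) /=; last by rewrite rA permM tpermL E.
rewrite permM tpermL E; congr (_ * _).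
apply: eq_big => [y|y].
  rewrite !finset.in_setD1; have [->|yr] /= := eqVneq y r; first by rewrite !andbF.
  have [->|yx] /= := eqVneq y x.
    by rewrite permM tpermR E' [(x < r)%N]ltnNge (ltnW ltrx) !andbF.
  by rewrite permM tpermD ?andbT // eq_sym.
move=> /andP[/andP[yA lt] yr].
have yx : y != x.
  by apply: contraTneq lt => ->; rewrite permM tpermR E' -leqNgt ltnW.
by rewrite permM tpermD // eq_sym.
Qed.

Definition wick A z w : R :=
  \sum_(D : {set 'I_p} | D \subset A) (\prod_(j in D) z j) * pairings (A :\: D) w.

Lemma wick0 z w : wick finset.set0 z w = 1.
Proof.
rewrite /wick (big_pred1 finset.set0) => [|D]; last by rewrite finset.subset0.
by rewrite big1 ?mul1r ?finset.setD0 ?pairings0 // => j; rewrite inE.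
Qed.

(** Either r lies in [D] and contributes its mean, or it is the least element of the complement and
    is paired with some x; the sums over [D] and x are then exchanged. *)
Lemma wick_rec A z w r : r \in A -> (forall x, x \in A -> (r <= x)%N) ->
  wick A z w = z r * wick (A :\ r) z w +
     \sum_(x in A :\ r) w r x * wick (A :\ r :\ x) z w.
Proof.
move=> rA rmin; rewrite /wick (bigID (fun D : {set 'I_p} => r \in D)) /=; congr (_ + _).
  rewrite (reindex_onto (fun D => r |: D) (fun D => D :\ r)) /=; last first.
    by move=> D /andP[_ rD]; rewrite finset.setD1K.
  rewrite mulr_sumr; apply: eq_big => [D|D].
    rewrite finset.setU11 andbT finset.subUset finset.sub1set rA /= finset.subsetD1; congr (_ && _).
    apply/eqP/idP => [<-|rD]; first by rewrite !inE eqxx.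
    by apply/finset.setP => y; rewrite !inE; case: eqVneq => //= ->; rewrite (negPf rD).
  move=> /andP[_ /eqP E]; have rD : r \notin D by rewrite -E !inE eqxx.
  by rewrite big_setU1 //= mulrA finset.setDDl.
under eq_bigr => D /andP[DA rD].
  rewrite (@pairings_rec _ _ r) ?inE ?rA ?rD //; last first.
    by move=> x /finset.setDP[xA _]; apply: rmin.
  rewrite mulr_sumr; over.
rewrite (exchange_big_dep (mem (A :\ r))) /=; last first.
  by move=> D x _; rewrite !inE => /and3P[-> _ ->].
apply: eq_bigr => x; rewrite finset.in_setD1 => /andP[xr xA].
rewrite mulr_sumr; apply: eq_big => [D|D _].
  rewrite !inE xr xA /= andbT !finset.subsetD1.
  by rewrite -andbA.
rewrite mulrCA; congr (_ * (_ * pairings _ _)).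
by apply/finset.setP => y; rewrite !inE; case: (y \in D); rewrite /= ?andbF.
Qed.

Lemma enum_min A r : r \in A -> (forall x, x \in A -> (r <= x)%N) ->
  enum A = r :: enum (A :\ r).
Proof.
move=> rA rmin; apply: (@sorted_eq _ (fun x y : 'I_p => (x <= y)%N)).
- by move=> ? ? ?; apply: leq_trans.
- by move=> x y /anti_leq /val_inj.
- rewrite /enum_mem sorted_filter // ; first by move=> ? ? ?; apply: leq_trans.
  by rewrite -enumT -(sorted_map (f := val)) val_enum_ord iota_sorted.
- rewrite /= path_sortedE; last by move=> ? ? ?; apply: leq_trans.
  apply/andP; split.
    by apply/allP => x; rewrite mem_enum => /finset.setD1P[_ /rmin].
  rewrite /enum_mem sorted_filter // ; first by move=> ? ? ?; apply: leq_trans.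
  by rewrite -enumT -(sorted_map (f := val)) val_enum_ord iota_sorted.
- apply: uniq_perm; rewrite /= ?enum_uniq ?mem_enum ?inE ?eqxx //.
  by move=> x; rewrite inE !mem_enum !inE; case: eqVneq => [->|].
Qed.

(** The recursion peels off the head of the list, that is the least index, exactly as in [wick_rec];
    it therefore determines [V] from its value on the empty word. *)
Lemma wick_unique (E : eqType) (z : E -> R) (w : E -> E -> R) (V : seq E -> R)
    (f : 'I_p -> E) :
  (forall e s, V (e :: s) = z e * V s + der_tr (w e) V s) ->
  forall A, V [seq f j | j <- enum A] =
    V [::] * wick A (fun j => z (f j)) (fun r x => w (f r) (f x)).
Proof.
move=> HV A; have [n] := ubnP #|A|; elim: n A => // n IH A ltA.
have [->|[r0 r0A]] := set_0Vmem A; first by rewrite enum_set0 wick0 mulr1.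
have [r rA rmin] : exists2 r, r \in A & forall x, x \in A -> (r <= x)%N.
  by case: (arg_minnP (fun x : 'I_p => val x) r0A) => r rA H; exists r.
have cA : #|A| = #|A :\ r|.+1 by rewrite (cardsD1 r A) rA.
(* Letters [f j] may coincide but indices do not, so the derivation is pulled back to indices, where
   deletion is unambiguous. *)
rewrite (enum_min rA rmin) /= HV der_tr_map der_tr_uniq ?enum_uniq //.
rewrite (wick_rec _ _ rA rmin) mulrDr IH; last by rewrite -ltnS -cA.
rewrite mulrCA; congr (_ + _).
rewrite big_enum mulr_sumr; apply: eq_bigr => x xA.
have -> : rem x (enum (A :\ r)) = enum (A :\ r :\ x).
  rewrite rem_filter ?enum_uniq // /enum_mem -filter_predI; apply: eq_filter => y.
  by rewrite /= !inE.
rewrite IH; last first.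
  apply: (@leq_ltn_trans #|A :\ r|); last by rewrite -ltnS -cA.
  by apply: subset_leq_card; apply: finset.subsetDl.
by rewrite mulrCA.
Qed.

End Involutions.

(** * Heisenberg modes and normally ordered products *)

Arguments hmode : simpl never.

Section Fock.
Variables (k : nat) (G : 'M[int]_k) (B : 'M[C]_k).
Local Notation E := ('I_k * nat)%type.
Local Notation hm := (hmode G B).

Definition mwt (la : monom k) : nat := \sum_(e <- enum_mset la) e.2.+1.

Lemma perm_mset1D (e : E) (la : {mset E}) :
  perm_eq (enum_mset (e +` la)) (e :: enum_mset la).
Proof.
have -> : e +` la = seq_mset (e :: enum_mset la).
  by apply/msetP => y; rewrite mset1DE mset_seqE /= count_mem_mset eq_sym.
exact: perm_eq_seq_mset.
Qed.

Lemma mwtD (e : E) (la : {mset E}) : mwt (e +` la) = (e.2.+1 + mwt la)%N.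
Proof. by rewrite /mwt (perm_big _ (perm_mset1D e la)) big_cons. Qed.

Lemma size_mset1D (e : E) (la : {mset E}) :
  size (enum_mset (e +` la)) = (size (enum_mset la)).+1.
Proof. by rewrite (perm_size (perm_mset1D e la)). Qed.

Lemma mwt_mem (e : E) (la : {mset E}) : e \in la -> (e.2.+1 <= mwt la)%N.
Proof. by move=> /msetB1K <-; rewrite mwtD leq_addr. Qed.

Lemma size_le_mwt (la : monom k) : (size (enum_mset la) <= mwt la)%N.
Proof.
rewrite /mwt; elim: (enum_mset la) => [|e s IH]; first by rewrite big_nil.
by rewrite big_cons /= addSn ltnS (leq_trans IH) // leq_addl.
Qed.

Lemma finite_mwt N : finite_set [set la : monom k | mwt la = N].
Proof.
(* Every factor has weight at least 1, so there are at most N factors, with mode indices below N. *)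
pose T := N.-bseq ('I_k * 'I_N.+1)%type.
pose f (s : T) : monom k := seq_mset [seq (x.1, val x.2) | x <- s].
apply: (@sub_finite_set _ _ (f @` setT)%classic); last first.
  by apply: finite_image; apply: finite_finset.
move=> la /= Hla.
have sz : (size [seq (e.1, inord e.2 : 'I_N.+1) | e <- enum_mset la] <= N)%N.
  by rewrite size_map -Hla size_le_mwt.
exists (Bseq sz) => //; rewrite /f /= -map_comp -[RHS]seq_mset_id; congr seq_mset.
rewrite -[RHS]map_id; apply/eq_in_map => -[a m] em /=.
rewrite inordK // -Hla ltnS ltnW //; exact: (@mwt_mem (a, m)).
Qed.

Lemma mset1DB (e e' : E) (x : {mset E}) : e != e' -> (e' +` x) `\ e = e' +` (x `\ e).
Proof.
move=> ne; apply/msetP => y; rewrite msetB1E !mset1DE msetB1E.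
by case: (eqVneq y e) ne => [->|//]; rewrite ?subn0 // => /negPf ->.
Qed.

Lemma msetB1C (e e' : E) (x : {mset E}) : x `\ e `\ e' = x `\ e' `\ e.
Proof. by apply/msetP => y; rewrite !msetB1E subnAC. Qed.

Lemma hmodeZD a n c f g :
  hm a n (fun y => c * f y + g y) = fun x => c * hm a n f x + hm a n g x.
Proof.
apply/funext => x; case: n => [[|m]|m]; rewrite /hmode; try by ring.
by case: ifP => _; rewrite ?mulr0 ?addr0.
Qed.

Lemma hmodeC_neg a m b l f :
  hm a (Negz m) (hm b (Negz l) f) = hm b (Negz l) (hm a (Negz m) f).
Proof.
apply/funext => x; rewrite /hmode /=.
have [->//|ne] := eqVneq (a, m) (b, l).
rewrite !in_msetB1 (negPf ne) eq_sym (negPf ne) /= msetB1C.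
by case: ((a, m) \in x.2); case: ((b, l) \in x.2).
Qed.

Lemma hmodeC_nneg a (m : nat) b (l : nat) f : hm a m (hm b l f) = hm b l (hm a m f).
Proof.
apply/funext => x; case: m => [|m]; case: l => [|l]; rewrite /hmode /=; try by ring.
have [[-> ->]//|ne] := eqVneq (a, m) (b, l).
rewrite !mset1DE (negPf ne) eq_sym (negPf ne) /= !add0n.
have -> : (b, l) +` ((a, m) +` x.2) = (a, m) +` ((b, l) +` x.2) by rewrite msetDCA.
by ring.
Qed.

Lemma hmode_comm0 a m b f : hm b 0 (hm a (Negz m) f) = hm a (Negz m) (hm b 0 f).
Proof. by apply/funext => x; rewrite /hmode /=; case: ifP; rewrite ?mulr0. Qed.

Lemma hmode_comm a m b l f x :
  hm b l.+1 (hm a (Negz m) f) x =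
  hm a (Negz m) (hm b l.+1 f) x + ((b == a) && (l == m))%:R * m.+1%:R * f x.
Proof.
rewrite /hmode /=; have [[-> ->]|ne] := eqVneq (b, l) (a, m).
  rewrite !eqxx mset1D1 msetD1K -surjective_pairing mul1r.
  case: (boolP ((a, m) \in x.2)) => ex.
    rewrite msetB1E eqxx /= msetB1K // -surjective_pairing.
    have : (0 < x.2 (a, m))%N by rewrite mset_gt0.
    by case: (x.2 (a, m)) => // c _; rewrite subn1 /= !natrM -[c.+2%:R]natr1; ring.
  by have /mset_eq0P -> := ex; rewrite muln1 add0r.
have -> : (b == a) && (l == m) = false by apply: negbTE; rewrite -xpair_eqE.
rewrite !mul0r addr0 in_mset1D eq_sym (negPf ne) /=.
rewrite mset1DB 1?eq_sym // msetB1E (negPf ne) subn0.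
by case: ifP; rewrite ?mulr0.
Qed.

Definition linop (A : fvec k -> fvec k) := forall c f g,
  A (fun y => c * f y + g y) = fun y => c * A f y + A g y.

Lemma linop0 A : linop A -> A (fun=> 0) = fun=> 0.
Proof.
move=> H; apply/funext => x; have := congr1 (fun f => f x) (H (-1) (fun=> 0) (fun=> 0)).
have -> : (fun _ : fbasis k => -1 * 0 + 0 : C) = fun=> 0.
  by apply/funext => y; rewrite mulr0 addr0.
by rewrite mulN1r addNr.
Qed.

Lemma linopZ A c f : linop A -> A (fun y => c * f y) = fun y => c * A f y.
Proof.
move=> H; have := H c f (fun=> 0); rewrite (linop0 H) => E.
have -> : (fun y => c * f y) = (fun y => c * f y + 0).
  by apply/funext => y; rewrite addr0.
by rewrite E; apply/funext => y; rewrite addr0.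
Qed.

Lemma linopD A f g : linop A -> A (fun y => f y + g y) = fun y => A f y + A g y.
Proof.
move=> H; have := H 1 f g; have -> : (fun y => 1 * f y + g y) = (fun y => f y + g y).
  by apply/funext => y; rewrite mul1r.
by move=> ->; apply/funext => y; rewrite mul1r.
Qed.

Lemma linop_sum A I (r : seq I) (c : I -> C) (f : I -> fvec k) : linop A ->
  A (fun y => \sum_(i <- r) c i * f i y) = fun y => \sum_(i <- r) c i * A (f i) y.
Proof.
move=> H; elim: r => [|i r IH].
  rewrite (_ : (fun y => _) = fun=> 0) ?linop0 //; last first.
    by apply/funext => y; rewrite big_nil.
  by apply/funext => y; rewrite big_nil.
rewrite (_ : (fun y => _) = fun y => c i * f i y + \sum_(j <- r) c j * f j y); last first.
  by apply/funext => y; rewrite big_cons.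
by rewrite H IH; apply/funext => y; rewrite big_cons.
Qed.

Lemma linop_der_tr A (F : seq E -> fvec k) w s : linop A ->
  A (fun y => der_tr w (fun t => F t y) s) = fun y => der_tr w (fun t => A (F t) y) s.
Proof.
move=> H; elim: s F => [|e s IH] F /=; first exact: linop0.
by rewrite H IH.
Qed.

Lemma linop_hmode a n : linop (hm a n).
Proof. by move=> c f g; rewrite hmodeZD. Qed.

(* Creation and annihilation parts of the field of the state [h_a(-(m+1)) 1],
   [e = (a, m)], truncated to the modes [h_a(n)] with [|n| <= K]. *)
Definition cre K (e : E) (f : fvec k) : fvec k := fun x =>
  \sum_(m < K) gbinom m e.2 * hm e.1 (Negz m) f x.
Definition ann K (e : E) (f : fvec k) : fvec k := fun x =>
  gbinom (-1) e.2 * hm e.1 0 f x +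
  \sum_(m < K) gbinom (- m.+1%:Z - 1) e.2 * hm e.1 m.+1 f x.

(** The normally ordered product built one field at a time: the creation part of the head acts after
    everything else, its annihilation part before. No sorting of modes is involved, which suits
    induction. *)
Fixpoint nprod K (s : seq E) (f : fvec k) : fvec k :=
  if s is e :: s' then fun x => cre K e (nprod K s' f) x + nprod K s' (ann K e f) x
  else f.

Lemma linop_cre K e : linop (cre K e).
Proof.
move=> c f g; apply/funext => x; rewrite /cre mulr_sumr -big_split.
by apply: eq_bigr => i _; rewrite hmodeZD /=; ring.
Qed.

Lemma linop_ann K e : linop (ann K e).
Proof.
move=> c f g; apply/funext => x; rewrite /ann.
rewrite mulrDr mulr_sumr addrACA -big_split; congr (_ + _).
  by rewrite hmodeZD; ring.
by apply: eq_bigr => i _; rewrite hmodeZD /=; ring.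
Qed.

Lemma linop_nprod K s : linop (nprod K s).
Proof.
elim: s => [//|e s IH] c f g /=; rewrite IH linop_cre linop_ann IH.
by apply/funext => x; ring.
Qed.

(** For m < K, [ann_comm] and [cre_comm] are the scalars [ann K e, h_a(-(m+1))] and
    [h_a(m+1), cre K e]. *)
Definition ann_comm a m (e : E) : C :=
  (e.1 == a)%:R * (m.+1%:R * gbinom (- m.+1%:Z - 1) e.2).
Definition cre_comm a m (e : E) : C := (e.1 == a)%:R * (m.+1%:R * gbinom m e.2).

Lemma hmodeC_cre K a m e f : hm a (Negz m) (cre K e f) = cre K e (hm a (Negz m) f).
Proof.
rewrite /cre (linop_sum _ _ _ (linop_hmode a (Negz m))); apply/funext => x.
by apply: eq_bigr => i _; rewrite hmodeC_neg.
Qed.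

Lemma hmodeC_ann K a (m : nat) e f : hm a m (ann K e f) = ann K e (hm a m f).
Proof.
rewrite /ann linop_hmode (linop_sum _ _ _ (linop_hmode a m)); apply/funext => x.
rewrite hmodeC_nneg; congr (_ + _).
by apply: eq_bigr => i _; rewrite hmodeC_nneg.
Qed.

Lemma ann_hmode K a m e f : (m < K)%N ->
  ann K e (hm a (Negz m) f) = fun x => hm a (Negz m) (ann K e f) x + ann_comm a m e * f x.
Proof.
move=> ltm; apply/funext => x.
rewrite /ann linop_hmode (linop_sum _ _ _ (linop_hmode a (Negz m))).
rewrite hmode_comm0 -addrA; congr (_ + _).
under eq_bigr => i _ do rewrite hmode_comm mulrDr.
rewrite big_split /=; congr (_ + _); rewrite (bigD1 (Ordinal ltm)) //= big1 => [|i ne].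
  by rewrite eqxx andbT addr0 /ann_comm; ring.
by rewrite -val_eqE /= in ne; rewrite (negPf ne) andbF !mul0r mulr0.
Qed.

Lemma hmode_cre K a m e f : (m < K)%N ->
  hm a m.+1 (cre K e f) = fun x => cre K e (hm a m.+1 f) x + cre_comm a m e * f x.
Proof.
move=> ltm; apply/funext => x.
rewrite /cre (linop_sum _ _ _ (linop_hmode a m.+1)).
under eq_bigr => i _ do rewrite hmode_comm mulrDr.
rewrite big_split /=; congr (_ + _); rewrite (bigD1 (Ordinal ltm)) //= big1 => [|i ne].
  by rewrite eqxx andbT addr0 /cre_comm eq_sym; ring.
by rewrite -val_eqE /= eq_sym in ne; rewrite (negPf ne) andbF !mul0r mulr0.
Qed.

(** The mode commutes with all creation parts and has scalar commutators with annihilation parts, so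
    moving it through the product deletes one field at a time. *)
Lemma nprod_hmode K a m s f : (m < K)%N ->
  nprod K s (hm a (Negz m) f) = fun x => hm a (Negz m) (nprod K s f) x
    + der_tr (ann_comm a m) (fun t => nprod K t f x) s.
Proof.
move=> ltm; elim: s f => [|e s IH] f /=; first by apply/funext => x; rewrite addr0.
rewrite IH (linopD _ _ (@linop_cre K e)) (linop_der_tr _ _ _ (@linop_cre K e)).
rewrite (linopD _ _ (linop_hmode _ _)) ann_hmode // (linopD _ _ (@linop_nprod K s)).
rewrite (linopZ _ _ (@linop_nprod K s)) IH hmodeC_cre; apply/funext => x.
by rewrite der_trD; ring.
Qed.

Lemma hmode_nprod K a m s f : (m < K)%N ->
  hm a m.+1 (nprod K s f) = fun x => nprod K s (hm a m.+1 f) x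
    + der_tr (cre_comm a m) (fun t => nprod K t f x) s.
Proof.
move=> ltm; elim: s f => [|e s IH] f /=; first by apply/funext => x; rewrite addr0.
rewrite (linopD _ _ (linop_hmode _ _)) hmode_cre // IH IH.
rewrite (linopD _ _ (@linop_cre K e)) (linop_der_tr _ _ _ (@linop_cre K e)).
rewrite -hmodeC_ann; apply/funext => x.
by rewrite der_trD; ring.
Qed.

End Fock.

(** * Traces *)

(* The series [e q^(m+1) / (1 - e q^(m+1))]. *)
Definition psgeom (e : C) (m : nat) : psring := fun N =>
  if (0 < N)%N && (m.+1 %| N)%N then e ^+ (N %/ m.+1) else 0.

Lemma psgeomE e m : psgeom e m = psC e * psq m.+1 * (1 + psgeom e m).
Proof.
apply/funext => N; rewrite -mulrA psCME psqME psDE ps1E /psgeom.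
case: (leqP m.+1 N) => [le|lt] /=; last first.
  rewrite mulr0; case: ifP => // /andP[N0 dv].
  by have := dvdn_leq N0 dv; rewrite leqNgt lt.
have -> : (m.+1 %| N - m.+1)%N = (m.+1 %| N)%N by rewrite dvdn_subl.
have -> : (0 < N)%N by apply: leq_trans le.
case: (boolP (m.+1 %| N)%N) => dv /=; last first.
  rewrite andbF addr0; case: eqP => [E|_]; last by rewrite mulr0.
  have EN : N = m.+1 by lia.
  by rewrite EN dvdnn in dv.
rewrite andbT; have [n EN] := dvdnP dv; rewrite EN mulnK //.
case: n EN => [|n] EN; first by rewrite EN in le.
rewrite mulSn addKn muln_gt0 andbT mulnK // muln_eq0 orbF.
by case: n {EN} => [|n]; rewrite ?addr0 ?add0r ?mulr1 ?expr1 ?exprS.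
Qed.

Lemma psgeom_uniq e m X Y : X = psC e * psq m.+1 * (X + Y) -> X = psgeom e m * Y.
Proof.
set u := psC e * psq m.+1 => HX.
have uV : (1 - u) * (1 + psgeom e m) = 1.
  by rewrite mulrBl mul1r -psgeomE addrK.
apply: (ps_mulr_inj uV); rewrite mulrBl mul1r {1}HX mulrDr addrC addKr.
by rewrite mulrA mulrBl mul1r {1}psgeomE -/u mulrDr mulr1 addrK.
Qed.

Section Trace.
Variables (k : nat) (G : 'M[int]_k) (B : 'M[C]_k) (eps : C) (be : 'rV[int]_k).
Local Notation E := ('I_k * nat)%type.
Local Notation hm := (hmode G B).
Implicit Type A : fvec k -> fvec k.

(* Trace on [M (x) e^be] of [eps^(number of factors) o A q^(L(0) - (be,be)/2)]. *)
Definition ftrace A : psring := fun N =>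
  \sum_(la \in [set la : monom k | mwt la = N])
     eps ^+ size (enum_mset la) * A (deltaB (be, la)) (be, la).

Definition monoms N : seq (monom k) := fset_set [set la : monom k | mwt la = N].

Lemma ftraceE A N : ftrace A N =
  \sum_(la <- monoms N) eps ^+ size (enum_mset la) * A (deltaB (be, la)) (be, la).
Proof. by rewrite /ftrace fsbig_finite //; exact: finite_mwt. Qed.

Lemma ftraceD A A' : ftrace (fun f x => A f x + A' f x) = ftrace A + ftrace A'.
Proof.
apply/funext => N; rewrite psDE !ftraceE -big_split.
by apply: eq_bigr => la _; rewrite mulrDr.
Qed.

Lemma ftraceZ c A : ftrace (fun f x => c * A f x) = psC c * ftrace A.
Proof.
apply/funext => N; rewrite psCME !ftraceE mulr_sumr.
by apply: eq_bigr => la _; rewrite mulrCA.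
Qed.

Lemma ftrace0 : ftrace (fun f x => 0) = 0.
Proof. by apply/funext => N; rewrite ftraceE big1 // => la _; rewrite mulr0. Qed.

Lemma ftrace_sum I (r : seq I) (c : I -> C) (A : I -> fvec k -> fvec k) :
  ftrace (fun f x => \sum_(i <- r) c i * A i f x) = \sum_(i <- r) psC (c i) * ftrace (A i).
Proof.
elim: r => [|i r IH].
  by rewrite big_nil -ftrace0; congr ftrace; apply/funext => f; apply/funext => x; rewrite big_nil.
rewrite big_cons -IH -ftraceZ -ftraceD; congr ftrace.
by apply/funext => f; apply/funext => x; rewrite big_cons.
Qed.

Lemma ftrace_der_tr (F : seq E -> fvec k -> fvec k) w s :
  ftrace (fun f x => der_tr w (fun t => F t f x) s) =
  der_tr (fun e => psC (w e)) (fun t => ftrace (F t)) s.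
Proof.
elim: s F => [|e s IH] F /=; first exact: ftrace0.
by rewrite ftraceD ftraceZ IH.
Qed.

Lemma hmode_neg_deltaB a m (la : monom k) :
  hm a (Negz m) (deltaB (be, la)) = deltaB (be, (a, m) +` la).
Proof.
apply/funext => -[b x]; rewrite /hmode /deltaB !xpair_eqE /=.
case: (boolP ((a, m) \in x)) => ex.
  congr (nat_of_bool (_ && _))%:R; apply/eqP/eqP => [<-|->].
    by rewrite msetB1K.
  by rewrite msetD1K.
rewrite [x == _](_ : _ = false) ?andbF //.
by apply: contraNF ex => /eqP ->; rewrite mset1D1.
Qed.

Lemma hmode_pos_deltaB a m (la : monom k) :
  hm a m.+1 (deltaB (be, la)) =
  fun y => (m.+1 * la (a, m))%:R * deltaB (be, la `\ (a, m)) y.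
Proof.
apply/funext => -[b x]; rewrite /hmode /deltaB !xpair_eqE /=.
case: (boolP ((a, m) \in la)) => el.
  have -> : ((a, m) +` x == la) = (x == la `\ (a, m)).
    by apply/eqP/eqP => [<-|->]; rewrite ?msetD1K ?msetB1K.
  case: (eqVneq x _) => [->|_]; last by rewrite andbF !mulr0.
  rewrite msetB1E eqxx /=; have : (0 < la (a, m))%N by rewrite mset_gt0.
  by case: (la _) => // c _; rewrite subn1.
have /mset_eq0P -> := el; rewrite muln0 mul0r.
rewrite [_ +` _ == _](_ : _ = false) ?andbF ?mulr0 //.
by apply: contraNF el => /eqP <-; rewrite mset1D1.
Qed.

Lemma hmode0_deltaB a (la : monom k) :
  hm a 0 (deltaB (be, la)) = fun y => hpair G B a be * deltaB (be, la) y.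
Proof.
apply/funext => -[b x]; rewrite /hmode /deltaB !xpair_eqE /=.
by case: eqVneq => [->//|_]; rewrite !mulr0.
Qed.

(** Monomials of weight N divisible by the variable e are e times an arbitrary monomial of weight N
    - (e.2+1). *)
Lemma fsum_mwt_mset1D (e : E) N (F : monom k -> C) :
  (forall la, mwt la = N -> e \notin la -> F la = 0) ->
  \sum_(la \in [set la : monom k | mwt la = N]) F la =
  if (e.2 < N)%N then
    \sum_(nu \in [set nu : monom k | mwt nu = (N - e.2.+1)%N]) F (e +` nu)
  else 0.
Proof.
move=> F0; case: ltnP => [lt|le]; last first.
  apply: fsbig1 => la /= wla; apply: F0 => //; apply/negP => /mwt_mem.
  by rewrite wla ltnNge le.
rewrite -(@fsbig_widen _ _ _ _ [set la : monom k | mwt la = N /\ e \in la]); first last.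
- by move=> la /= [wla /not_andP[//|/negP nla]]; apply: F0.
- by move=> la /= [].
apply: (@reindex_fsbig _ _ _ _ _ (fun nu : monom k => e +` nu : monom k)); split.
- by move=> nu /= wnu; split; [rewrite mwtD wnu subnKC|rewrite mset1D1].
- by move=> x y _ _ /(congr1 (fun z => z `\ e)); rewrite !msetD1K.
- move=> la /= [wla ela]; exists (la `\ e); last by rewrite msetB1K.
  by have := mwtD e (la `\ e); rewrite msetB1K // wla /= => ->; rewrite addKn.
Qed.

(** Only monomials divisible by the created variable have a diagonal entry; stripping that variable
    costs one factor eps and weight m+1. *)
Lemma ftrace_cre A a m :
  ftrace (fun f => hm a (Negz m) (A f)) =
  psC eps * psq m.+1 * ftrace (fun f => A (hm a (Negz m) f)).
Proof.
apply/funext => N; rewrite -mulrA psCME psqME /ftrace (fsum_mwt_mset1D (e := (a, m))).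
  case: ifP => _; last by rewrite mulr0.
  rewrite mulr_fsumr; apply: eq_fsbigr => nu _.
  by rewrite size_mset1D exprS hmode_neg_deltaB /hmode /= mset1D1 msetD1K mulrA.
by move=> la _ nla; rewrite /hmode /= (negPf nla) mulr0.
Qed.

(** As for [ftrace_cre], but the multiplicity now arises before [A] acts; linearity carries it
    through, and it matches the factor of h_a(m+1) on the other side. *)
Lemma ftrace_ann A a m : linop A ->
  ftrace (fun f => A (hm a m.+1 f)) =
  psC eps * psq m.+1 * ftrace (fun f => hm a m.+1 (A f)).
Proof.
move=> HA; apply/funext => N.
rewrite -mulrA psCME psqME /ftrace (fsum_mwt_mset1D (e := (a, m))).
  case: ifP => _; last by rewrite mulr0.
  rewrite mulr_fsumr; apply: eq_fsbigr => nu _.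
  rewrite size_mset1D exprS hmode_pos_deltaB linopZ // msetD1K mset1DE eqxx add1n.
  by rewrite /hmode /= -!mulrA.
by move=> la _ /mset_eq0P E0; rewrite hmode_pos_deltaB linopZ // E0 muln0 mul0r mulr0.
Qed.

Variable K : nat.
Local Notation T := (fun s => ftrace (nprod G B K s)).

Lemma ftrace_hmode_neg a m s : (m < K)%N ->
  ftrace (fun f => hm a (Negz m) (nprod G B K s f)) =
  psgeom eps m * der_tr (fun e => psC (ann_comm a m e)) T s.
Proof.
move=> ltm; apply: psgeom_uniq; rewrite {1}ftrace_cre -ftrace_der_tr -ftraceD.
by congr (_ * _); congr ftrace; apply/funext => f; rewrite nprod_hmode.
Qed.

Lemma ftrace_hmode_pos a m s : (m < K)%N ->
  ftrace (fun f => nprod G B K s (hm a m.+1 f)) =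
  psgeom eps m * der_tr (fun e => psC (cre_comm a m e)) T s.
Proof.
move=> ltm; apply: psgeom_uniq; rewrite {1}ftrace_ann; last exact: linop_nprod.
rewrite -ftrace_der_tr -ftraceD.
by congr (_ * _); congr ftrace; apply/funext => f; rewrite hmode_nprod.
Qed.

(** The two products of binomials correspond to [e] contributing the creation or the annihilation
    mode. The constant term is zero, since factors inside a normal ordering are not contracted with
    each other. *)
Definition fcov (e e' : E) : psring := (e.1 == e'.1)%:R *
  \sum_(m < K) psC (m.+1%:R * (gbinom m e.2 * gbinom (- m.+1%:Z - 1) e'.2 +
                               gbinom (- m.+1%:Z - 1) e.2 * gbinom m e'.2)) * psgeom eps m.

Definition fmean (e : E) : psring := psC (gbinom (-1) e.2 * hpair G B e.1 be).

Lemma ftrace_nprod_rec e s : T (e :: s) = fmean e * T s + der_tr (fcov e) T s.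
Proof.
have -> : T (e :: s) = ftrace (fun f => cre G B K e (nprod G B K s f)) +
                       ftrace (fun f => nprod G B K s (ann G B K e f)).
  by rewrite -ftraceD.
have -> : ftrace (fun f => nprod G B K s (ann G B K e f)) =
    fmean e * T s + \sum_(m < K) psC (gbinom (- m.+1%:Z - 1) e.2) *
        ftrace (fun f => nprod G B K s (hm e.1 m.+1 f)).
  rewrite -ftrace_sum -ftraceZ -ftraceD; apply/funext => N; rewrite !ftraceE.
  apply: eq_bigr => la _; congr (_ * _).
  rewrite /ann (linop_nprod _ _ _ s) (linop_sum _ _ _ (linop_nprod _ _ _ s)).
  rewrite hmode0_deltaB (linopZ _ _ (linop_nprod _ _ _ s)) mulrA; congr (_ + _).
rewrite /cre ftrace_sum addrCA; congr (_ + _); rewrite -big_split /=.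
have -> : der_tr (fcov e) T s = \sum_(m < K) psgeom eps m *
    (psC (gbinom m e.2) * der_tr (fun e' => psC (ann_comm e.1 m e')) T s +
     psC (gbinom (- m.+1%:Z - 1) e.2) * der_tr (fun e' => psC (cre_comm e.1 m e')) T s).
  under [RHS]eq_bigr => m _ do rewrite -!der_tr_wZ -der_tr_wD.
  rewrite -der_tr_w_sum; apply: eq_der_tr => // e'; rewrite /fcov mulr_sumr.
  apply: eq_bigr => m _; rewrite /ann_comm /cre_comm [e'.1 == _]eq_sym.
  by rewrite !rmorphM !rmorphD !rmorphM /= !rmorph_nat; ring.
by apply: eq_bigr => m _; rewrite ftrace_hmode_neg // ftrace_hmode_pos //; ring.
Qed.

End Trace.

(** * Zero modes of square-bracket states *)

Lemma big_iota0 (R : Type) (idx : R) (op : Monoid.law idx) n (F : nat -> R) :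
  \big[op/idx]_(i <- iota 0 n) F i = \big[op/idx]_(i < n) F i.
Proof. by rewrite -(big_mkord xpredT) /index_iota subn0. Qed.

Lemma perm_eq_rem (K : eqType) (e : K) t t' :
  perm_eq t t' -> perm_eq (rem e t) (rem e t').
Proof. by move=> H; apply/seq.permP => a; rewrite !count_rem (perm_mem H) (seq.permP H). Qed.

Lemma seq_mset_nil (K : choiceType) : seq_mset [::] = mset0 :> {mset K}.
Proof. by apply/msetP => y; rewrite mset_seqE mset0E. Qed.

Lemma seq_mset_cons (K : choiceType) (e : K) s : e +` seq_mset s = seq_mset (e :: s).
Proof. by apply/msetP => y; rewrite mset1DE !mset_seqE /= eq_sym. Qed.

Lemma seq_mset_rem (K : choiceType) (e : K) s :
  e \in s -> seq_mset s `\ e = seq_mset (rem e s).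
Proof.
by move=> es; apply/msetP => y; rewrite msetB1E !mset_seqE count_rem es /= eq_sym.
Qed.

Definition brack_dd k (an e : 'I_k * nat) : C :=
  (e.1 == an.1)%:R * (sbpos an.2 e.2 * e.2.+1%:R).

Local Notation sb_eval := (state_eval (fun n j => psC (sbneg n j))
                                      (fun an e => psC (brack_dd an e))).

Section ZeroModes.
Variables (k : nat) (G : 'M[int]_k) (B : 'M[C]_k).
Local Notation E := ('I_k * nat)%type.
Local Notation hm := (hmode G B).

Lemma nprodC K e e' s f : nprod G B K (e :: e' :: s) f = nprod G B K (e' :: e :: s) f.
Proof.
rewrite /=; have -> : ann G B K e' (ann G B K e f) = ann G B K e (ann G B K e' f).
  rewrite {1 4}/ann linop_ann (linop_sum _ _ _ (@linop_ann _ _ _ K e)).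
  by apply/funext => x; rewrite hmodeC_ann; congr (_ + _);
     apply: eq_bigr => i _; rewrite hmodeC_ann.
rewrite !(linopD _ _ (@linop_cre _ _ _ K _)).
have -> g : cre G B K e' (cre G B K e g) = cre G B K e (cre G B K e' g).
  rewrite {1 4}/cre (linop_sum _ _ _ (@linop_cre _ _ _ K e)).
  by apply/funext => x; apply: eq_bigr => i _; rewrite hmodeC_cre.
by apply/funext => x; exact: addrACA.
Qed.

(** A multiset is enumerated in an unspecified order; creation parts commute among themselves, and
    so do annihilation parts, hence the order is irrelevant. *)
Lemma nprod_perm K s t f : perm_eq s t -> nprod G B K s f = nprod G B K t f.
Proof.
have cons_cat e t1 t2 g :
    nprod G B K (e :: t1 ++ t2) g = nprod G B K (t1 ++ e :: t2) g.
  elim: t1 g => [//|e' t1 IH] g.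
  rewrite cat_cons nprodC -[LHS]/(fun x => cre G B K e' (nprod G B K (e :: t1 ++ t2) g) x
      + nprod G B K (e :: t1 ++ t2) (ann G B K e' g) x).
  by rewrite !IH.
elim: s t f => [|e s IH] t f; first by rewrite perm_sym => /perm_nilP ->.
move=> H; have et : e \in t by rewrite -(perm_mem H) mem_head.
case/splitPr: et H => t1 t2 H; rewrite -cons_cat /=.
have Ht : perm_eq s (t1 ++ t2).
  by rewrite -(perm_cons e); apply: perm_trans H _; rewrite (perm_catCA t1 [:: e] t2).
by rewrite !(IH (t1 ++ t2)).
Qed.

Lemma nord_neg a m s f : nord G B ((a, Negz m) :: s) f = hm a (Negz m) (nord G B s f).
Proof. by []. Qed.

Lemma nord_nneg a (m : nat) s f : nord G B ((a, m%:Z) :: s) f = nord G B s (hm a m f).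
Proof.
rewrite /nord /= !foldr_cat /=; congr foldr.
elim: s => [//|[b [l|l]] s IH] //=.
by rewrite -IH hmodeC_nneg.
Qed.

(** The window [-K, K], listed as negative, zero and positive modes to match [cre] and [ann]. *)
Definition box K : seq int := [seq Negz m | m <- iota 0 K] ++ 0 :: [seq m.+1%:Z | m <- iota 0 K].
Fixpoint boxes K p : seq (seq int) :=
  if p is p'.+1 then [seq n :: ns | n <- box K, ns <- boxes K p'] else [:: [::]].

Lemma mem_box K n : (n \in box K) = (`|n| <= K)%N.
Proof.
rewrite mem_cat in_cons; apply/or3P/idP => [[/mapP[m]|/eqP->|/mapP[m]]|] //.
- by rewrite mem_iota => /andP[_ lt] ->.
- by rewrite mem_iota => /andP[_ lt] ->.
case: n => [[|n]|n] le; [exact: Or32|apply: Or33|apply: Or31]; apply/mapP;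
  by exists n => //; rewrite mem_iota.
Qed.

Lemma uniq_box K : uniq (box K).
Proof.
rewrite cat_uniq cons_uniq !map_inj_uniq ?iota_uniq ?andbT; try by move=> x y [].
apply/and3P; split=> //; last by apply/mapP => -[].
apply/hasPn => x; rewrite in_cons => /orP[/eqP->|/mapP[m _ ->]].
  by apply/negP => /mapP[].
by apply/negP => /mapP[].
Qed.

Lemma mem_boxes K p ns : (ns \in boxes K p) = (size ns == p) && all (mem (box K)) ns.
Proof.
elim: p ns => [|p IH] ns; first by rewrite inE /=; case: ns.
apply/allpairsP/andP => [[[n ns'] /= [Hn]]|].
  by rewrite IH => /andP[/eqP sz al] ->; rewrite /= sz Hn al.
case: ns => [[]//|n ns] /= [/eqP[sz] /andP[Hn al]].
by exists (n, ns); rewrite IH sz eqxx.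
Qed.

Lemma uniq_boxes K p : uniq (boxes K p).
Proof.
elim: p => //= p IH; apply: allpairs_uniq => //; first exact: uniq_box.
by move=> [? ?] [? ?] _ _ [-> ->].
Qed.

(** Without the condition that the modes sum to 0, the sum over a box factors mode by mode and
    follows the recursion of [nprod]. *)
Lemma sum_boxes_nord K (es : seq E) f x :
  \sum_(ns <- boxes K (size es))
     (\prod_(pr <- zip es ns) gbinom (- pr.2 - 1) pr.1.2)
     * nord G B [seq (pr.1.1, pr.2) | pr <- zip es ns] f x = nprod G B K es f x.
Proof.
elim: es f x => [|e es IH] f x; first by rewrite big_seq1 big_nil mul1r.
rewrite /= big_allpairs_dep big_cat /= !big_map; congr (_ + _).
  rewrite /cre big_iota0; apply: eq_bigr => m _.
  rewrite -[nprod G B K es f]/(fun x => nprod G B K es f x).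
  under [X in _ * hm _ _ X _]eq_fun do rewrite -IH.
  rewrite (linop_sum _ _ _ (@linop_hmode _ _ _ e.1 (Negz m))) mulr_sumr.
  apply: eq_bigr => ns _; rewrite big_cons /= nord_neg mulrA; congr (_ * _ * _).
  by congr gbinom; rewrite NegzE; lia.
rewrite big_cons big_map /ann (linop_nprod _ _ _ es) (linop_sum _ _ _ (@linop_nprod _ _ _ K es)).
have pos m : \sum_(ns <- boxes K (size es))
     (\prod_(pr <- zip (e :: es) (m%:Z :: ns)) gbinom (- pr.2 - 1) pr.1.2)
     * nord G B [seq (pr.1.1, pr.2) | pr <- zip (e :: es) (m%:Z :: ns)] f x =
  gbinom (- m%:Z - 1) e.2 * nprod G B K es (hm e.1 m f) x.
  rewrite -IH mulr_sumr; apply: eq_bigr => ns _.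
  by rewrite /= big_cons /= nord_nneg mulrA.
congr (_ + _); first exact: (pos 0%N).
rewrite big_iota0; apply: eq_bigr => m _; exact: pos.
Qed.

Definition fwt (w : int) (f : fvec k) := forall y, f y != 0 -> (mwt y.2)%:Z = w.

Lemma fwt_hmode w a n f : fwt w f -> fwt (w - n) (hm a n f).
Proof.
move=> H [b x]; rewrite /hmode /=; case: n => [[|m]|m].
- by rewrite mulf_eq0 negb_or => /andP[_ /H <-] /=; rewrite subr0.
- rewrite mulf_eq0 negb_or => /andP[_ /H] /=; rewrite mwtD /= => <-; lia.
- case: (boolP ((a, m) \in x)) => [ex|]; last by rewrite eqxx.
  by move=> /H /= <-; rewrite -{1}(msetB1K ex) mwtD NegzE /=; lia.
Qed.

Definition modes (s : seq ('I_k * int)) (f : fvec k) : fvec k :=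
  foldr (fun an g => hm an.1 an.2 g) f s.

Lemma fwt_modes w s f : fwt w f -> fwt (w - \sum_(j <- s) j.2) (modes s f).
Proof.
move=> H; elim: s => [|[a n] s IH] /=; first by rewrite big_nil subr0.
rewrite big_cons /= opprD addrA addrAC; exact: fwt_hmode.
Qed.

Lemma linop_modes s : linop (modes s).
Proof.
elim: s => [//|[a n] s IH] c f g /=.
by rewrite IH linop_hmode.
Qed.

Lemma le_sum_nneg (s : seq ('I_k * int)) j : all (fun an => 0 <= an.2) s -> j \in s ->
  j.2 <= \sum_(i <- s) i.2.
Proof.
move=> /allP al js; rewrite (big_rem j) //= lerDl big_seq sumr_ge0 // => i /mem_rem.
exact: al.
Qed.

(** Weights force the modes to sum to 0. The vector obtained after the annihilation modes is nonzero
    of weight w - SP, so SP <= w; since the creation modes restore the weight, every mode is bounded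
    by w. *)
Lemma nord_neq0 w (s : seq ('I_k * int)) f x : fwt w f -> (mwt x.2)%:Z = w ->
  nord G B s f x != 0 ->
  \sum_(j <- s) j.2 = 0 /\ (forall j, j \in s -> (`|j.2| <= mwt x.2)%N).
Proof.
move=> fw xw.
pose N : seq ('I_k * int) := [seq an <- s | an.2 < 0].
pose P : seq ('I_k * int) := [seq an <- s | 0 <= an.2].
pose SP : int := \sum_(j <- P) j.2; pose SN : int := \sum_(j <- N) j.2.
have -> : nord G B s f = modes N (modes P f) by rewrite /nord -/(modes _ _) /modes foldr_cat.
move=> nz; have [y Hy] : exists y, modes P f y != 0.
  apply/not_existsP => H; have E0 : modes P f = fun=> 0.
    by apply/funext => y; have /negP/negPn/eqP := H y.
  by rewrite E0 (linop0 (@linop_modes N)) eqxx in nz.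
have wy : (mwt y.2)%:Z = w - SP := fwt_modes fw Hy.
have wx : (mwt x.2)%:Z = w - SP - SN := fwt_modes (fwt_modes fw (s := P)) nz.
have E : \sum_(j <- s) j.2 = SP + SN.
  rewrite /SP /SN.
  rewrite !big_filter (bigID (fun j : 'I_k * int => 0 <= j.2)) /=; congr (_ + _).
  by apply: eq_bigl => j; rewrite ltNge.
split; first by rewrite E; lia.
move=> j js; case: (leP 0 j.2) => j0.
  have jP : j \in P by rewrite mem_filter j0.
  have : j.2 <= SP := le_sum_nneg (filter_all _ _) jP; lia.
have jN : (j.1, - j.2) \in [seq (i.1, - i.2) | i <- N].
  by apply/mapP; exists j; rewrite // mem_filter j0.
have : - j.2 <= - SN.
  have := @le_sum_nneg _ _ _ jN; rewrite big_map /= sumrN; apply.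
  by apply/allP => i /mapP[i' /[!mem_filter]/andP[lt _] ->] /=; rewrite oppr_ge0 ltW.
lia.
Qed.

(** On a matrix entry between vectors of equal weight at most [K], neither the cutoff nor dropping
    the zero-sum condition changes anything. *)
Lemma zmode_monoE w K (mu : monom k) f x : fwt w f -> (mwt x.2)%:Z = w -> (mwt x.2 <= K)%N ->
  zmode_mono G B mu f x = nprod G B K (enum_mset mu) f x.
Proof.
move=> fw xw leK; rewrite -sum_boxes_nord /zmode_mono; set es := enum_mset mu.
set F := fun ns => _ * nord _ _ _ _ _.
have F0 ns : size ns = size es -> F ns != 0 ->
    \sum_(j <- ns) j = 0 /\ all (mem (box K)) ns.
  move=> sz; rewrite /F mulf_eq0 negb_or => /andP[_ /(nord_neq0 fw xw)].
  rewrite big_map -(big_map snd xpredT id) /= -/(unzip2 _) unzip2_zip ?sz // => -[E al].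
  split=> //; apply/allP => j jn /=; rewrite mem_box.
  rewrite -[ns](@unzip2_zip _ _ es) ?sz // in jn; have [pr prz Ej] := mapP jn.
  apply: leq_trans leK; have := al (pr.1.1, pr.2); rewrite -Ej; apply.
  by apply/mapP; exists pr; rewrite // Ej.
rewrite (@fsbigE _ _ _ _ _ [seq ns <- boxes K (size es) | \sum_(j <- ns) j == 0]); first last.
- move=> ns /= [sz E]; apply: contraNeq => /(F0 _ sz)[_ al].
  by rewrite mem_filter E eqxx mem_boxes sz eqxx.
- by move=> ns /=; rewrite mem_filter mem_boxes => /andP[/eqP ? /andP[/eqP ? _]].
- by rewrite filter_uniq // uniq_boxes.
rewrite big_filter_cond [RHS](bigID (fun ns : seq int => \sum_(j <- ns) j == 0)) /=.
rewrite [X in _ + X]big1_seq ?addr0; last first.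
  move=> ns /andP[ne]; rewrite mem_boxes => /andP[/eqP sz _].
  by apply/eqP; apply: contraNT ne => /(F0 _ sz)[->].
rewrite big_seq_cond [RHS]big_seq_cond; apply: eq_bigl => ns.
case: (boolP (ns \in _)) => //= Hns; case: eqP => //= E.
apply/mem_set; split => //; by move: Hns; rewrite mem_boxes => /andP[/eqP].
Qed.

(** Vectors are arbitrary functions, while the sums over all modes and all monomials need finite
    support; an explicit list, repetitions allowed, supplies it. *)
Definition lincomb (l : seq (C * seq E)) : fvec k :=
  fun x => \sum_(p <- l) p.1 * deltaB (0, seq_mset p.2 : monom k) x.

Lemma lincomb_eval (l : seq (C * seq E)) (F : monom k -> C) :
  \sum_(mu \in [set: monom k]) lincomb l (0, mu) * F mu =
  \sum_(p <- l) p.1 * F (seq_mset p.2).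
Proof.
set r := undup [seq (seq_mset p.2 : monom k) | p <- l].
have inr p : p \in l -> seq_mset p.2 \in r.
  by move=> pl; rewrite mem_undup; apply/mapP; exists p.
rewrite (@fsbigE _ _ _ _ _ r) ?undup_uniq //; last first.
  move=> mu _ nmu; rewrite /lincomb big1_seq ?mul0r // => p /andP[_ pl].
  rewrite /deltaB xpair_eqE eqxx /=; case: eqP => [E|_]; last by rewrite mulr0.
  by rewrite E inr in nmu.
under eq_bigl => mu do rewrite in_setT.
under eq_bigr => mu _ do rewrite /lincomb mulr_suml.
rewrite exchange_big /= !big_seq; apply: eq_bigr => p pl.
rewrite (bigD1_seq (seq_mset p.2)) ?undup_uniq ?inr //= /deltaB eqxx mulr1 big1 ?addr0 //.
by move=> mu ne; rewrite xpair_eqE eqxx (negPf ne) mulr0 mul0r.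
Qed.

Definition brack_list (an : 'I_k * nat) (l : seq (C * seq E)) : seq (C * seq E) :=
  [seq (p.1 * sbneg an.2 j, (an.1, j) :: p.2) | p <- l, j <- iota 0 an.2] ++
  [seq (p.1 * brack_dd an e, rem e p.2) | p <- l, e <- p.2].

Lemma hpair0 a : hpair G B a 0 = 0.
Proof. by rewrite /hpair map_mx0 trmx0 mulmx0 mxE. Qed.

Lemma hbrack_lincomb an l :
  hbrack G B an.1 (- an.2%:Z) (lincomb l) = lincomb (brack_list an l).
Proof.
case: an => a n; apply/funext => x; rewrite /hbrack [RHS]/lincomb big_cat /=.
have hml m : hm a m (lincomb l) x =
    \sum_(p <- l) p.1 * hm a m (deltaB (0, seq_mset p.2 : monom k)) x.
  by rewrite /lincomb (linop_sum _ _ _ (@linop_hmode _ _ _ a m)).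
(* A bound on all mode indices in [l]: h_a(m+1) with m >= M annihilates the vector, and h_a(0) does
   so because the lattice part is 0. *)
pose M := \sum_(p <- l) \sum_(e <- p.2) e.2.+1.
have ltM p e : p \in l -> e \in p.2 -> (e.2 < M)%N.
  move=> pl ep; rewrite /M (big_rem p pl) /= (big_rem e ep) /=; lia.
rewrite (@fsbigE _ _ _ _ _ ([seq Negz j | j <- iota 0 n] ++ [seq m.+1%:Z | m <- iota 0 M])) //;
  first last.
- move=> [[|m]|j] _; rewrite mem_cat negb_or => /andP[n1 n2].
  + rewrite hml big1 ?mulr0 // => p _; rewrite hmode0_deltaB hpair0 mul0r mulr0 //.
  + rewrite hml big1_seq ?mulr0 // => p /andP[_ pl]; rewrite hmode_pos_deltaB mset_seqE.
    rewrite [count_mem _ _](_ : _ = 0%N) ?muln0 ?mul0r ?mulr0 //.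
    apply/count_memPn; apply: contra n2 => /(ltM _ _ pl) /= lt.
    by apply/mapP; exists m; rewrite ?mem_iota.
  + rewrite -/(sbneg n j) sbneg_ge ?mul0r // leqNgt; apply: contra n1 => lt.
    by apply/mapP; exists j; rewrite ?mem_iota.
- rewrite cat_uniq !map_inj_uniq ?iota_uniq ?andbT /=; try by move=> ? ? [].
  by apply/hasPn => y /mapP[m _ ->]; apply/negP => /mapP[].
under eq_bigl => m do rewrite in_setT.
rewrite big_cat !big_map /= !big_allpairs_dep /=; congr (_ + _).
  rewrite exchange_big /=; apply: eq_bigr => j _.
  rewrite -/(sbneg n j) hml mulr_sumr; apply: eq_bigr => p _.
  by rewrite hmode_neg_deltaB seq_mset_cons mulrA [sbneg _ _ * _]mulrC.
under eq_bigr => m _ do rewrite -/(sbpos n m) hml mulr_sumr.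
rewrite exchange_big /= big_seq [RHS]big_seq; apply: eq_bigr => p pl.
under eq_bigr => m _ do rewrite hmode_pos_deltaB mset_seqE -sum1_count natrM natr_sum.
(* The multiplicity produced by annihilation is rewritten as a sum over the occurrences of the
   letter in the list. *)
rewrite (eq_bigr (fun m => \sum_(e <- p.2) (e == (a, m))%:R *
   (p.1 * (sbpos n m * m.+1%:R) * deltaB (0, seq_mset (rem (a, m) p.2) : monom k) x))); last first.
  move=> m _; rewrite mulr_sumr big_mkcond /= mulr_suml !mulr_sumr.
  rewrite big_seq [RHS]big_seq; apply: eq_bigr => e ep.
  case: eqP => [E|_]; last by rewrite !(mulr0, mul0r).
  rewrite seq_mset_rem -?E // mul1r.
  by move: (deltaB _ x) => d; ring.
rewrite exchange_big /= big_seq [RHS]big_seq; apply: eq_bigr => -[b m] ep.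
rewrite /brack_dd /=; case: (eqVneq b a) => [Eb|ne]; last first.
  rewrite big1 ?mul0r ?mulr0 ?mul0r // => m' _.
  by rewrite xpair_eqE (negPf ne) mul0r.
rewrite (bigD1_seq m) ?iota_uniq ?mem_iota //=; last exact: (ltM _ _ pl ep).
rewrite Eb eqxx big1 ?addr0 ?mul1r // => m' ne.
by rewrite xpair_eqE [m == _]eq_sym (negPf ne) andbF mul0r.
Qed.

Definition state_list (s : seq ('I_k * nat)) : seq (C * seq E) :=
  foldr brack_list [:: (1, [::])] s.

Lemma sb_stateE s : sb_state G B s = lincomb (state_list s).
Proof.
elim: s => [|an s IH] /=; last by rewrite -hbrack_lincomb -IH.
apply/funext => x; rewrite /lincomb big_seq1 mul1r /vac /=.
by rewrite seq_mset_nil.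
Qed.

(** Expanding the state and then applying a functional agrees with transposing the modes one by one
    onto the functional; symmetry of [F] absorbs the order of the letters. *)
Lemma state_list_eval s (F : seq E -> psring) :
  (forall t t', perm_eq t t' -> F t = F t') ->
  \sum_(p <- state_list s) psC p.1 * F p.2 = sb_eval s F.
Proof.
elim: s F => [|an s IH] F HF /=; first by rewrite big_seq1 rmorph1 mul1r.
rewrite -IH; last first.
  move=> t t' Ht; rewrite /mode_tr; congr (_ + _).
    by apply: eq_bigr => j _; congr (_ * _); apply: HF; rewrite perm_cons.
  rewrite !der_tr_perm // (perm_big _ Ht); apply: eq_bigr => e _.
  by congr (_ * _); apply: HF; apply: perm_eq_rem.
rewrite big_cat !big_allpairs_dep /= -big_split; apply: eq_bigr => p _ /=.
rewrite /mode_tr der_tr_perm // mulrDr !mulr_sumr; congr (_ + _).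
  rewrite big_iota0; apply: eq_bigr => j _.
  by rewrite rmorphM mulrA.
by apply: eq_bigr => e _; rewrite rmorphM mulrA.
Qed.

Lemma zmode_sb_state w K s f x : fwt w f -> (mwt x.2)%:Z = w -> (mwt x.2 <= K)%N ->
  zmode G B (sb_state G B s) f x = \sum_(p <- state_list s) p.1 * nprod G B K p.2 f x.
Proof.
move=> fw xw leK; rewrite /zmode sb_stateE lincomb_eval; apply: eq_bigr => p _.
rewrite (zmode_monoE _ fw xw leK); congr (_ * _).
by rewrite (nprod_perm _ _ (perm_eq_seq_mset p.2)).
Qed.

Lemma fwt_deltaB b la : fwt (mwt la) (deltaB (b, la)).
Proof.
by move=> y; rewrite /deltaB; case: (y =P _) => [->//|_]; rewrite eqxx.
Qed.

Lemma trace_sb_state eps be K N s : (N <= K)%N ->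
  \sum_(la <- monoms k N) eps ^+ size (enum_mset la) *
     zmode G B (sb_state G B s) (deltaB (be, la)) (be, la) =
  sb_eval s (fun t => ftrace eps be (nprod G B K t)) N.
Proof.
move=> leK; rewrite -state_list_eval; last first.
  by move=> t t' Ht; congr ftrace; apply/funext => f; apply: nprod_perm.
rewrite ps_sumE; under [RHS]eq_bigr => p _ do rewrite psCME ftraceE mulr_sumr.
rewrite exchange_big /= big_seq [RHS]big_seq; apply: eq_bigr => la.
rewrite in_fset_set; last exact: finite_mwt.
rewrite inE /= => wla.
rewrite (zmode_sb_state (K := K) s (@fwt_deltaB be la)) //=; last by rewrite wla.
by rewrite mulr_sumr; apply: eq_bigr => p _; rewrite mulrCA.
Qed.

End ZeroModes.

(** * Lattice sums and characters *)

Section Lattice.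
Variables (k : nat) (G : 'M[int]_k).
Hypothesis Gsym : G^T = G.
Hypothesis Geven : forall a : 'rV[int]_k, (2 %| lform G a a)%Z.
Hypothesis Gpos : forall a : 'rV[int]_k, a != 0 -> 0 < lform G a a.
Hypothesis Gdet : \det G != 0.
Local Notation lf := (lform G).

Lemma lformC a b : lf a b = lf b a.
Proof.
rewrite /lform -[RHS](_ : ((b *m G *m a^T)^T) 0 0 = _); last by rewrite mxE.
by rewrite !trmx_mul trmxK Gsym mulmxA.
Qed.

Lemma lform_lin c a b d : lf (c *: a + b) d = c * lf a d + lf b d.
Proof. by rewrite /lform !mulmxDl -!scalemxAl !mxE. Qed.

Lemma lform_ge0 a : 0 <= lf a a.
Proof.
have [->|/Gpos/ltW//] := eqVneq a 0.
by rewrite /lform !mul0mx mxE.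
Qed.

(** Expand the nonnegative norm of (v,v) u - (u,v) v and divide by (v,v). *)
Lemma lform_CS u v : lf u v ^+ 2 <= lf u u * lf v v.
Proof.
have [->|v0] := eqVneq v 0.
  by rewrite lformC /lform !mul0mx !mxE expr0n mulr0.
have Q0 := Gpos v0; set Q := lf v v in Q0 *.
have := lform_ge0 (Q *: u + (- lf u v) *: v).
rewrite lform_lin -[(- lf u v) *: v]addr0 lform_lin.
have -> : lf 0 (Q *: u + (- lf u v *: v + 0)) = 0 by rewrite /lform !mul0mx mxE.
rewrite !addr0 ![lf _ (Q *: u + _)]lformC !lform_lin.
rewrite -[(- lf u v) *: v]addr0 !lform_lin.
have z d : lf 0 d = 0 by rewrite /lform !mul0mx mxE.
rewrite !z !addr0 -/Q (lformC v u) => H.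
have : 0 <= Q * (lf u u * Q - lf u v ^+ 2).
  apply: le_trans H _; rewrite le_eqVlt; apply/orP; left; apply/eqP; ring.
by rewrite pmulr_rge0 // subr_ge0.
Qed.

Definition qn (b : 'rV[int]_k) : nat := `|(lf b b %/ 2)%Z|%N.

Lemma qnE b : lf b b = (2 * qn b)%:Z.
Proof.
rewrite /qn; have /dvdzP[c Ec] := Geven b; have := lform_ge0 b; rewrite Ec mulzK //.
by move=> h; clear -h; lia.
Qed.

Lemma qn_div b : (lf b b %/ 2)%Z = qn b.
Proof. by rewrite qnE PoszM mulrC mulzK. Qed.

(** The adjugate gives integral vectors whose pairing with b is det G times a coordinate of b, so
    Cauchy-Schwarz bounds every coordinate. *)
Lemma finite_qn N : finite_set [set b : 'rV[int]_k | (qn b <= N)%N].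
Proof.
pose v i : 'rV[int]_k := delta_mx 0 i *m (\adj G)^T.
have Hv b i : lf b (v i) = \det G * b 0 i.
  rewrite /lform /v trmx_mul trmxK mulmxA -[_ *m G *m \adj G]mulmxA mul_mx_adj.
  rewrite mul_mx_scalar -scalemxAl mxE trmx_delta -colE mxE; congr (_ * _).
pose M := (\sum_i 2 * N * `|lf (v i) (v i)|)%N.
pose f (t : 'rV['I_(2 * M).+1]_k) : 'rV[int]_k :=
  map_mx (fun x : 'I_(2*M).+1 => (x : nat)%:Z - M%:Z) t.
apply: (@sub_finite_set _ _ (f @` setT)%classic); last first.
  by apply: finite_image; apply: finite_finset.
move=> b /= Hb.
pose z (i : 'I_k) : int := b 0 i.
have bd i : (`|z i| <= M)%N.
  have := lform_CS b (v i); rewrite Hv -/(z i) qnE => CS.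
  have : (`|z i| <= 2 * N * `|lf (v i) (v i)|)%N.
    have := lform_ge0 (v i); move: (lf (v i) (v i)) CS => Q CS Q0.
    have d1 : 1 <= (\det G) ^+ 2.
      by rewrite -gtz0_ge1 lt_neqAle sqr_ge0 eq_sym sqrf_eq0 Gdet.
    have h1 : z i ^+ 2 <= (2 * qn b)%:Z * Q.
      by apply: le_trans CS; rewrite exprMn -[X in X <= _]mul1r ler_wpM2r ?sqr_ge0.
    have h2 : (2 * qn b)%:Z * Q <= (2 * N)%:Z * Q.
      by apply: ler_wpM2r => //; rewrite lez_nat leq_mul2l Hb orbT.
    have h3 := le_trans h1 h2; clear CS h1 h2; case: Q Q0 h3 => // Q _ h.
    have : (`|z i| ^ 2 <= 2 * N * Q)%N.
      by rewrite -lez_nat PoszM -abszX gez0_abs ?sqr_ge0.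
    by apply: leq_trans; rewrite -mulnn; case: (`|z i|)%N => // c; rewrite leq_pmulr.
  by move=> h; apply: leq_trans h _; rewrite /M (bigD1 i) //= leq_addr.
exists (\row_i inord `|(z i + M%:Z)%R|) => //.
apply/rowP => i; rewrite !mxE -/(z i) inordK; have := bd i; lia.
Qed.

End Lattice.

Section LatticeSums.
Variables (k : nat) (G : 'M[int]_k).
Hypothesis Gsym : G^T = G.
Hypothesis Geven : forall a : 'rV[int]_k, (2 %| lform G a a)%Z.
Hypothesis Gpos : forall a : 'rV[int]_k, a != 0 -> 0 < lform G a a.
Hypothesis Gdet : \det G != 0.

Definition latt N : seq 'rV[int]_k := fset_set [set b : 'rV[int]_k | (qn G b <= N)%N].

Lemma mem_latt N b : (b \in latt N) = (qn G b <= N)%N.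
Proof.
rewrite in_fset_set; last exact: finite_qn.
by apply/idP/idP => [/set_mem|/mem_set].
Qed.

Lemma mem_monoms N (la : monom k) : (la \in monoms k N) = (mwt la == N).
Proof.
rewrite in_fset_set; last exact: finite_mwt.
by apply/idP/eqP => [/set_mem|/mem_set].
Qed.

Lemma wtE b (la : monom k) : wt G (b, la) = (qn G b + mwt la)%:Z.
Proof. by rewrite /wt /= qn_div // PoszD. Qed.

Lemma sum_wt N (F : fbasis k -> C) :
  \sum_(x \in [set x : fbasis k | wt G x = N%:Z]) F x =
  \sum_(b <- latt N) \sum_(la <- monoms k (N - qn G b)) F (b, la).
Proof.
pose r := [seq (b, la) | b <- latt N, la <- monoms k (N - qn G b)].
transitivity (\sum_(x <- r) F x); last by rewrite big_allpairs_dep.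
have inr x : (x \in r) = (wt G x == N%:Z).
  case: x => b la; rewrite wtE; apply/allpairsPdep/eqP => [[b' [la' []]]|].
    by rewrite mem_latt mem_monoms => h1 /eqP h2 [-> ->]; rewrite h2 subnKC.
  case=> E; exists b, la; rewrite mem_latt mem_monoms -E leq_addr; split=> //.
  by rewrite addKn.
apply: fsbig_fwiden.
- by move=> x /= /eqP; rewrite inr.
- apply: allpairs_uniq_dep; first exact: fset_uniq.
    by move=> b _; apply: fset_uniq.
  by move=> [b la] [b' la'] _ _ /= [-> ->].
- by move=> x /= [/[!inr]/eqP].
Qed.

Lemma theta_sum N (P : 'rV[int]_k -> C) (X : psring) :
  \sum_(b <- latt N) P b * X (N - qn G b)%N = ((thetaL G P : psring) * X) N.
Proof.
rewrite psME (eq_big_seq (fun b => \sum_(j < N.+1)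
    if qn G b == j then P b * X (N - j)%N else 0)); last first.
  move=> b; rewrite mem_latt => le; rewrite -big_mkcond /=.
  by rewrite (big_pred1 (Ordinal (le : (qn G b < N.+1)%N))) // => j; rewrite eq_sym.
rewrite exchange_big /=; apply: eq_bigr => j _.
rewrite -big_mkcond /= -mulr_suml; congr (_ * _); rewrite /thetaL -big_filter.
apply/esym/fsbig_fwiden.
- move=> b /= E; rewrite mem_filter mem_latt.
  have -> : qn G b = j by have := qnE Geven Gpos b; rewrite E; lia.
  by rewrite eqxx -ltnS ltn_ord.
- by rewrite filter_uniq // fset_uniq.
- move=> b /= [/[!mem_filter] /andP[/eqP E _]] nE; case: nE.
  by rewrite (qnE Geven Gpos) E.
Qed.

End LatticeSums.

(** * The character of the Fock space as an inverse power of eta *)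

Section Partition.
Variable k : nat.
Local Notation E := ('I_k * nat)%type.

Definition fchar (eps : C) : psring := fun N =>
  \sum_(la <- monoms k N) eps ^+ size (enum_mset la).

Definition fchar_on (S : seq E) : psring := fun N =>
  \sum_(la \in [set la : monom k | mwt la = N]) ((all (mem S) (enum_mset la))%:R : C).

Lemma fchar_on_nil : fchar_on [::] = 1.
Proof.
apply/funext => N; rewrite /fchar_on ps1E.
rewrite -(@fsbig_widen _ _ _ _ [set la : monom k | mwt la = N /\ la = mset0]); first last.
- move=> la /= [w /not_andP[//|n0]].
  case E : (enum_mset la) => [|e s] //=.
  by case: n0; rewrite -[la]seq_mset_id E seq_mset_nil.
- by move=> la [].
have w0 : mwt (mset0 : monom k) = 0%N by rewrite /mwt enum_mset0 big_nil.
case: N => [|N].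
  rewrite (_ : [set _ | _] = [set mset0])%classic ?fsbig_set1 ?enum_mset0 //.
  by apply/seteqP; split=> la /= => [[]|->].
rewrite fsbig1 // => la /= [w E]; by rewrite E w0 in w.
Qed.

(** A monomial in e and [S] either avoids e or is e times another such monomial. *)
Lemma fchar_on_cons e S : e \notin S ->
  (1 - psq e.2.+1) * fchar_on (e :: S) = fchar_on S.
Proof.
move=> eS; apply/eqP; rewrite mulrBl mul1r subr_eq; apply/eqP; apply/funext => N.
have dec (la : monom k) : (all (mem (e :: S)) (enum_mset la))%:R =
    (all (mem S) (enum_mset la))%:R +
    ((e \in la) && all (mem (e :: S)) (enum_mset la))%:R :> C.
  have inm f : (f \in enum_mset la) = (f \in la) by [].
  case: (boolP (e \in la)) => el /=; last first.
    rewrite addr0; congr (nat_of_bool _)%:R; apply: eq_in_all => f fl /=.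
    rewrite inE; case: eqP => // Ef; by rewrite -Ef -inm fl in el.
  rewrite [all (mem S) _](_ : _ = false) ?add0r //.
  by apply/negbTE/allPn; exists e.
rewrite psDE psqME /fchar_on (eq_fsbigr (fun la : monom k => (all (mem S) (enum_mset la))%:R +
    ((e \in la) && all (mem (e :: S)) (enum_mset la))%:R)); last first.
  by move=> la _; exact: dec.
rewrite fsbig_split; last exact: finite_mwt.
congr (_ + _); apply: etrans (fsum_mwt_mset1D (e := e) _) _.
  by move=> la _ /negPf ->.
case: ifP => // _; apply: eq_fsbigr => nu _.
by rewrite mset1D1 (perm_all _ (perm_mset1D e nu)) /= inE eqxx.
Qed.

Lemma fchar_on_prod S : uniq S ->
  (\prod_(e <- S) (1 - psq e.2.+1)) * fchar_on S = 1.
Proof.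
elim: S => [|e S IH] /=; first by rewrite big_nil mul1r fchar_on_nil.
move=> /andP[eS uS]; rewrite big_cons -[RHS]IH // -(fchar_on_cons eS).
by rewrite mulrAC mulrC mulrCA mulrA.
Qed.

(** The factors beyond the N-th start at q^(N+1), so the varying number of factors in [etaprod] is
    harmless. *)
Lemma etaprod_eqmod M :
  ps_eqmod M (etaprod : psring) (\prod_(m < M) (1 - psq m.+1)).
Proof.
pose p2s (p : {poly C}) : psring := fun n => p`_n.
have p2sM p r : p2s (p * r) = p2s p * p2s r by apply/funext => n; rewrite /p2s coefM.
have p2s1 : p2s 1 = 1 by apply/funext => n; rewrite /p2s coef1.
have p2sq m : p2s (1 - 'X^(m.+1)) = 1 - psq m.+1.
  by apply/funext => n; rewrite /p2s coefB coef1 coefXn psBE.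
have p2sP N : p2s (\prod_(m < N) (1 - 'X^(m.+1))) = \prod_(m < N) (1 - psq m.+1).
  by rewrite (big_morph p2s p2sM p2s1); apply: eq_bigr => m _.
have stab N d : (\prod_(m < N + d) (1 - psq m.+1) : psring) N =
                (\prod_(m < N) (1 - psq m.+1) : psring) N.
  elim: d => [|d IH]; first by rewrite addn0.
  rewrite addnS big_ord_recr /= mulrBr mulr1 psBE mulrC psqME ifF ?subr0 //.
  by apply/negbTE; rewrite -ltnNge ltnS leq_addr.
move=> N le; rewrite /etaprod -/(p2s _ N) p2sP -(subnKC le) stab //.
Qed.

Lemma fchar1 : fchar 1 = etainv k.
Proof.
apply/funext => N; rewrite /etainv ps_ipow_neg.
set ei : psring := ps_inv etaprod.
have eei : (etaprod : psring) * ei = 1.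
  apply: mulps_inv; rewrite /etaprod big_ord0 coef1 eqxx oner_neq0 //.
pose S := [seq (a, m) | a <- enum 'I_k, m <- iota 0 N].
have uS : uniq S.
  apply: allpairs_uniq; rewrite ?enum_uniq ?iota_uniq //.
  by move=> [? ?] [? ?] _ _ [-> ->].
have -> : fchar 1 N = fchar_on S N.
  rewrite /fchar /fchar_on fsbig_finite; last exact: finite_mwt.
  rewrite !big_seq; apply: eq_bigr => la; rewrite -/(monoms k N) mem_monoms => /eqP w.
  rewrite expr1n; have -> // : all (mem S) (enum_mset la).
  apply/allP => -[a m] am /=; apply/allpairsP; exists (a, m); split=> //=.
    by rewrite mem_enum.
  by rewrite mem_iota add0n -w; apply: (@mwt_mem _ (a, m)).
have EP : \prod_(e <- S) (1 - psq e.2.+1) = (\prod_(m < N) (1 - psq m.+1)) ^+ k :> psring.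
  rewrite big_allpairs_dep /= big_enum /=.
  under eq_bigr => a _ do rewrite big_iota0.
  by rewrite prodr_const card_ord.
have := fchar_on_prod uS; rewrite EP => H.
(* Both sides are multiplied by a disguised 1, so that they differ only in the k-th powers of
   [etaprod] and of its truncated product, which agree modulo q^(N+1). *)
have -> : fchar_on S = fchar_on S * ((etaprod : psring) * ei) ^+ k by rewrite eei expr1n mulr1.
have -> : ei ^+ k = ((\prod_(m < N) (1 - psq m.+1)) ^+ k * fchar_on S) * ei ^+ k by rewrite H mul1r.
rewrite exprMn mulrA [fchar_on S * _]mulrC -!mulrA.
apply: (@ps_eqmodM N) => //.
elim: (k) => [|j IH]; first by rewrite !expr0.
by rewrite !exprS; apply: ps_eqmodM => //; apply: etaprod_eqmod.
Qed.

End Partition.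

(** * Eisenstein series *)

Lemma hatcE n n' : hatc n.+1 n'.+1 =
  (-1) ^+ n' * ((n + n').+1)`!%:R / (n`!%:R * n'`!%:R).
Proof.
rewrite /hatc; have -> : (n.+1 + n'.+1 - 1 = (n + n').+1)%N by lia.
rewrite exprS exprS mulN1r mulN1r opprK -mulrA; congr (_ * _).
have <- := @bin_fact (n + n').+1 n'.+1; last by rewrite ltnS leq_addl.
have -> : ((n + n').+1 - n'.+1 = n)%N by rewrite subSS addnK.
rewrite factS !natrM; field.
by rewrite !factC_neq0.
Qed.

Lemma sum_divisors N K (F : nat -> C) : (0 < N <= K)%N ->
  \sum_(d <- divisors N) F d = \sum_(m < K) if (m.+1 %| N)%N then F m.+1 else 0.
Proof.
move=> /andP[N0 le]; rewrite -(big_mkord xpredT (fun m => if (m.+1 %| N)%N then F m.+1 else 0)).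
rewrite -big_mkcond /= -(big_map S (fun d => d %| N)%N F) -[RHS]big_filter.
apply: perm_big; apply: uniq_perm; rewrite ?divisors_uniq ?filter_uniq ?map_inj_uniq ?iota_uniq //.
  by move=> x y [].
move=> d; rewrite mem_filter -dvdn_divisors //; case: (boolP (d %| N)%N) => //= dN.
apply/esym/mapP; case: d dN => [|d] dN; first by move: dN; rewrite dvd0n => /eqP E; rewrite E in N0.
exists d => //; rewrite mem_iota /= add0n subn0.
exact: leq_trans (dvdn_leq N0 dN) le.
Qed.

(** * Mean and covariance of the square-bracket modes *)

Section Covariance.
Variables (k : nat) (G : 'M[int]_k) (B : 'M[C]_k) (be : 'rV[int]_k).
Local Notation E := ('I_k * nat)%type.

Definition bmean (an : E) : psring :=
  \sum_(j < an.2) psC (sbneg an.2 j) * fmean G B be (an.1, j : nat).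

(** [sbneg_gbinom] at x = -1 gives a power of 0, which is nonzero only for h[-1]. *)
Lemma bmeanE an : (0 < an.2)%N ->
  bmean an = psC (if an.2 == 1%N then hpair G B an.1 be else 0).
Proof.
case: an => a [//|n] _; rewrite /bmean /fmean /=.
under eq_bigr => j _ do rewrite -rmorphM /= mulrA.
rewrite -rmorph_sum -mulr_suml sbneg_gbinom addNr mulr0z expr0n eqSS.
by case: n => [|n]; rewrite ?fact0 ?divr1 ?mul1r ?mul0r.
Qed.

Definition bcov eps K (an bn : E) : psring :=
  \sum_(l < bn.2) psC (sbneg bn.2 l) *
     (\sum_(j < an.2) psC (sbneg an.2 j) * fcov eps K (an.1, j : nat) (bn.1, l : nat)
      + psC (brack_dd an (bn.1, l : nat))).

(** The double sum over j and l factors, and [sbneg_gbinom] evaluates the factors at x = m and x =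
    -m-2, giving powers of m+1 and -(m+1). *)
Lemma bcovE eps K a b n n' : bcov eps K (a, n.+1) (b, n'.+1) = (a == b)%:R *
  (\sum_(m < K) psC (m.+1%:R ^+ (n + n').+1 * (((-1) ^+ n + (-1) ^+ n') / (n`!%:R * n'`!%:R)))
      * psgeom eps m + psC (sbpair n.+1 n'.+1)).
Proof.
rewrite /bcov /=; under eq_bigr => l _ do rewrite mulrDr.
rewrite big_split mulrDr /=; congr (_ + _); last first.
  rewrite -(rmorph_nat psC) -rmorphM /= /sbpair mulr_sumr rmorph_sum /=.
  apply: eq_bigr => l _; rewrite -rmorphM /brack_dd /= eq_sym; congr psC; ring.
rewrite mulr_sumr /fcov /=.
transitivity (\sum_(m < K) (a == b)%:R * (psgeom eps m * psC (m.+1%:R *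
   ((\sum_(j < n.+1) sbneg n.+1 j * gbinom m j) *
    (\sum_(l < n'.+1) sbneg n'.+1 l * gbinom (- m.+1%:Z - 1) l) +
    (\sum_(j < n.+1) sbneg n.+1 j * gbinom (- m.+1%:Z - 1) j) *
    (\sum_(l < n'.+1) sbneg n'.+1 l * gbinom m l))))); last first.
  apply: eq_bigr => m _; congr (_ * _); rewrite mulrC; congr (psC _ * _).
  rewrite !sbneg_gbinom subrK.
  have -> : (m%:Z + 1)%:~R = m.+1%:R :> C by rewrite -[RHS]natr1 rmorphD.
  have -> : (- m.+1%:Z)%:~R = - m.+1%:R :> C by rewrite rmorphN.
  rewrite ![(- m.+1%:R) ^+ _]exprNn exprS exprD; field.
  by rewrite !factC_neq0.
have dbl (X Y : nat -> C) : psC ((\sum_(j < n.+1) sbneg n.+1 j * X j) *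
      (\sum_(l < n'.+1) sbneg n'.+1 l * Y l)) =
   \sum_(l < n'.+1) \sum_(j < n.+1) psC (sbneg n'.+1 l) * psC (sbneg n.+1 j) * psC (X j * Y l).
  rewrite mulr_sumr rmorph_sum; apply: eq_bigr => l _.
  rewrite mulr_suml rmorph_sum; apply: eq_bigr => j _.
  by rewrite -!rmorphM; congr psC; ring.
transitivity (\sum_(l < n'.+1) \sum_(j < n.+1) \sum_(m < K)
   (a == b)%:R * psgeom eps m * psC m.+1%:R *
   (psC (sbneg n'.+1 l) * psC (sbneg n.+1 j) * psC (gbinom m j * gbinom (- m.+1%:Z - 1) l) +
    psC (sbneg n'.+1 l) * psC (sbneg n.+1 j) * psC (gbinom (- m.+1%:Z - 1) j * gbinom m l))).
  apply: eq_bigr => l _; rewrite mulr_sumr; apply: eq_bigr => j _.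
  rewrite !mulr_sumr; apply: eq_bigr => m _.
  by rewrite rmorphM rmorphD /=; ring.
under eq_bigr => l _ do rewrite exchange_big.
rewrite exchange_big; apply: eq_bigr => m _ /=.
rewrite rmorphM rmorphD /= (dbl (gbinom m) (gbinom _)) (dbl (gbinom _) (gbinom m)) -big_split.
rewrite mulrA mulrA /= mulr_sumr; apply: eq_bigr => l _.
by rewrite -big_split mulr_sumr; apply: eq_bigr => j _.
Qed.

Lemma bcov_coef eps K a b n n' N : bcov eps K (a, n.+1) (b, n'.+1) N = (a == b)%:R *
  (\sum_(m < K) m.+1%:R ^+ (n + n').+1 * (((-1) ^+ n + (-1) ^+ n') / (n`!%:R * n'`!%:R))
      * psgeom eps m N + (if N == 0%N then sbpair n.+1 n'.+1 else 0)).
Proof.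
rewrite bcovE -(rmorph_nat psC) psCME psDE ps_sumE; congr (_ * (_ + _)).
by apply: eq_bigr => m _; rewrite psCME.
Qed.

(** The geometric series have no constant term, so only the contraction [sbpair] is left, for either
    sign. In odd total degree, which is at least 3 here, the Bernoulli number vanishes in agreement
    with the convention for [Eis]. *)
Lemma bcov_coef0 eps K a b n n' : bcov eps K (a, n.+1) (b, n'.+1) 0%N =
  (a == b)%:R * Ehat n.+1 n'.+1 0%N.
Proof.
rewrite bcov_coef big1 ?add0r => [|m _]; last by rewrite /psgeom mulr0.
congr (_ * _); rewrite /= sbpairE // /Ehat /ps_scale /Eis /=; congr (_ * _).
case: ifP => [on|_].
  by rewrite psginv_odd ?oppr0 //; apply/eqP; lia.
by rewrite /bernoulli mulNr [_ * ps_inv _ _]mulrC mulfK // factC_neq0.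
Qed.

(** The factor (-1)^n + (-1)^n' vanishes in odd total degree and otherwise supplies the 2 of the
    Eisenstein coefficients and the sign of [hatc]. *)
Lemma Ehat_coef a b n n' N K : (0 < N <= K)%N ->
  (a == b :> 'I_k)%:R * Ehat n.+1 n'.+1 N = (a == b)%:R *
   \sum_(m < K) m.+1%:R ^+ (n + n').+1 * (((-1) ^+ n + (-1) ^+ n') / (n`!%:R * n'`!%:R))
      * ((m.+1 %| N)%N)%:R.
Proof.
move=> HN; congr (_ * _).
have N0 : (N == 0%N) = false by lia.
rewrite /Ehat /ps_scale /Eis N0 hatcE addSn addnS /= negbK.
have sg : (-1) ^+ n = (-1) ^+ (odd (n + n')) * (-1) ^+ n' :> C.
  by rewrite -[LHS]signr_odd -[(-1) ^+ n']signr_odd oddD -signr_addb addbK.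
case: ifP => on; rewrite sg on /=.
  rewrite mulr0 big1 // => m _.
  by rewrite expr1 mulN1r addNr mul0r mulr0 mul0r.
rewrite expr0 mul1r (sum_divisors _ HN) mulrA !mulr_sumr; apply: eq_bigr => m _.
case: ifP => _; rewrite ?mulr0 // natrX mulr1.
by field; rewrite !factC_neq0.
Qed.

Lemma bcov1 K an bn : (0 < an.2)%N -> (0 < bn.2)%N ->
  ps_eqmod K (bcov 1 K an bn) (if an.1 == bn.1 then Ehat an.2 bn.2 else ps_zero).
Proof.
case: an bn => [a [//|n]] [b [//|n']] _ _ N le /=.
have -> : (if a == b then Ehat n.+1 n'.+1 else ps_zero) N = (a == b)%:R * Ehat n.+1 n'.+1 N.
  by case: eqP; rewrite ?mul1r ?mul0r.
case: N le => [|N] le; first exact: bcov_coef0.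
rewrite (@Ehat_coef _ _ _ _ _ K) // bcov_coef addr0; congr (_ * _).
apply: eq_bigr => m _; rewrite /psgeom /=; congr (_ * _).
by case: ifP; rewrite ?expr1n.
Qed.

(** A divisor m of N now enters with sign (-1)^(N/m), which is 2 - 1 if m also divides N/2 and -1
    otherwise. *)
Lemma bcovN1 K an bn : (0 < an.2)%N -> (0 < bn.2)%N ->
  ps_eqmod K (bcov (-1) K an bn) (if an.1 == bn.1 then Fhat an.2 bn.2 else ps_zero).
Proof.
case: an bn => [a [//|n]] [b [//|n']] _ _ N le /=.
have FE : Fhat n.+1 n'.+1 N =
    2 * (if ~~ odd N then Ehat n.+1 n'.+1 N./2 else 0) - Ehat n.+1 n'.+1 N.
  rewrite /Fhat /Ehat /ps_scale /Fis mulrBr mulrCA; congr (2 * _ - _).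
  by case: ifP; rewrite ?mulr0.
have -> : (if a == b then Fhat n.+1 n'.+1 else ps_zero) N = (a == b)%:R * Fhat n.+1 n'.+1 N.
  by case: eqP; rewrite ?mul1r ?mul0r.
case: N le FE => [|N] le FE.
  by rewrite bcov_coef0 FE; congr (_ * _); rewrite /= mulr_natl mulr2n addrK.
rewrite FE mulrBr [X in _ = X - _]mulrCA (@Ehat_coef _ _ _ _ _ K) // bcov_coef addr0.
case: ifP => [ev|od].
  rewrite (@Ehat_coef _ _ _ _ _ K); last by lia.
  rewrite [X in _ = X - _]mulrCA -mulrBr; congr (_ * _); rewrite mulr_sumr -sumrB; apply: eq_bigr => m _.
  rewrite /psgeom /= -[uphalf N]/(N.+1./2) [X in _ = X - _]mulrCA -mulrBr; congr (_ * _).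
  case: (boolP (m.+1 %| N.+1)%N) => [/dvdnP[c Ec]|nd].
    rewrite Ec mulnK // -signr_odd.
    have -> : (m.+1 %| (c * m.+1)./2)%N = ~~ odd c.
      apply/idP/idP => [/dvdnP[t Et]|ec].
        have : (c * m.+1 = (t * 2) * m.+1)%N by rewrite -Ec; lia.
        by move/eqP; rewrite eqn_pmul2r // => /eqP ->; rewrite oddM andbF.
      by rewrite -[c]odd_double_half (negPf ec) add0n -doubleMl doubleK dvdn_mull.
    by case: (odd c); rewrite /= ?expr1 ?expr0 ?mulr0 ?mulr1 ?sub0r // -natrB.
  rewrite [(m.+1 %| N.+1./2)%N](_ : _ = false) ?mulr0 ?subrr //.
  apply: contraNF nd => /dvdnP[t Et]; apply/dvdnP; exists (t * 2)%N; lia.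
(* For odd N every quotient N/m is odd, and the term with 2 tau is absent. *)
rewrite !mulr0 sub0r -mulrN; congr (_ * _); rewrite -sumrN; apply: eq_bigr => m _.
rewrite /psgeom /= -mulrN; congr (_ * _).
case: (boolP (m.+1 %| N.+1)%N) => [/dvdnP[c Ec]|_]; last by rewrite oppr0.
rewrite Ec mulnK // -signr_odd.
have -> : odd c by move/negbT: od; rewrite negbK Ec oddM => /andP[].
by rewrite expr1.
Qed.

End Covariance.

(** * The trace formula *)

Section Assembly.
Variables (k : nat) (G : 'M[int]_k) (B : 'M[C]_k).
Hypothesis Gsym : G^T = G.
Hypothesis Geven : forall a : 'rV[int]_k, (2 %| lform G a a)%Z.
Hypothesis Gpos : forall a : 'rV[int]_k, a != 0 -> 0 < lform G a a.
Hypothesis Gdet : \det G != 0.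
Local Notation E := ('I_k * nat)%type.
Local Notation hm := (hmode G B).

Definition supp_at (b : 'rV[int]_k) (f : fvec k) := forall y, y.1 != b -> f y = 0.

Lemma supp_hmode b a n f : supp_at b f -> supp_at b (hm a n f).
Proof.
move=> H y yb; rewrite /hmode; case: n => [[|m]|m]; rewrite ?H ?mulr0 //.
by case: ifP.
Qed.

Lemma supp_nprod b K s f : supp_at b f -> supp_at b (nprod G B K s f).
Proof.
elim: s f => [//|e s IH] f H y yb /=; rewrite IH ?addr0 //.
  rewrite /cre big1 // => m _; rewrite (@supp_hmode b) ?mulr0 //; exact: IH.
move=> z zb; rewrite /ann (@supp_hmode b) // mulr0 add0r big1 // => m _.
by rewrite (@supp_hmode b) ?mulr0.
Qed.

Local Notation tr eps be K := (fun t => ftrace eps be (nprod G B K t)).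

Lemma ZVL_sb_state s N K : (N <= K)%N -> ZVL G B (sb_state G B s) N =
  \sum_(b <- latt G N) sb_eval s (tr 1 b K) (N - qn G b)%N.
Proof.
move=> leK; rewrite /ZVL sum_wt //; apply: eq_bigr => b _.
rewrite -trace_sb_state; last by apply: leq_trans leK; apply: leq_subr.
by apply: eq_bigr => la _; rewrite expr1n mul1r.
Qed.

(** The zero mode preserves each M (x) e^b while the involution exchanges b and -b, so the trace of
    their product lives on b = 0, where the involution is (-1) to the number of factors. *)
Lemma ZVLplus_sb_state s N K : (N <= K)%N ->
  ZVLplus G B (sb_state G B s) N =
  1 / 2 * ZVL G B (sb_state G B s) N + 1 / 2 * sb_eval s (tr (-1) 0 K) N.
Proof.
move=> leK; rewrite /ZVLplus /ZVL !sum_wt //.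
have latt0 : 0 \in latt G N by rewrite mem_latt // /qn /lform !mul0mx mxE div0z.
have q0 : qn G 0 = 0%N by rewrite /qn /lform !mul0mx mxE div0z.
pose X b la := 1 / 2 * zmode G B (sb_state G B s) (deltaB (b, la)) (b, la).
pose Y b (la : monom k) := 1 / 2 * ((-1) ^+ size (enum_mset la) *
   zmode G B (sb_state G B s) (deltaB (- b, la)) (b, la)).
transitivity (\sum_(b <- latt G N) \sum_(la <- monoms k (N - qn G b)) (X b la + Y b la)).
  apply: eq_bigr => b _; apply: eq_bigr => la _; rewrite /X /Y.
  have th : theta (deltaB (b, la)) =
      fun y => (-1) ^+ size (enum_mset la) * deltaB (- b, la) y.
    apply/funext => -[b' la']; rewrite /theta /deltaB /= !xpair_eqE eqr_oppLR.
    by case: (eqVneq la' la) => [->//|_]; rewrite andbF !mulr0.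
  have fw : fwt (mwt la) (fun y => (deltaB (b, la) y + theta (deltaB (b, la)) y) / 2).
    move=> y; rewrite th /deltaB; case: (y =P (b, la)) => [->//|_].
    by case: (y =P (- b, la)) => [->//|_]; rewrite mulr0 addr0 mul0r eqxx.
  rewrite (@zmode_sb_state k G B _ (mwt la) s _ _ fw) //.
  rewrite !(@zmode_sb_state k G B _ (mwt la) s _ _ (@fwt_deltaB k _ la)) //.
  rewrite mulr_sumr mulr_sumr mulr_sumr -big_split; apply: eq_bigr => p _ /=.
  have -> : (fun y => (deltaB (b, la) y + theta (deltaB (b, la)) y) / 2) =
     fun y => 1 / 2 * deltaB (b, la) y + (1 / 2 * (-1) ^+ size (enum_mset la)) * deltaB (- b, la) y.
    rewrite th; apply/funext => y.
    by move: (deltaB _ y) (deltaB _ y) (_ ^+ _) (2^-1) => d d' c h; ring.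
  rewrite linop_nprod (linopZ _ _ (@linop_nprod _ _ _ _ _)).
  move: (nprod _ _ _ _ _ _) (nprod _ _ _ _ _ _) => u v; ring.
under eq_bigr => b _ do rewrite big_split.
rewrite big_split /=; congr (_ + _).
  by rewrite mulr_sumr; apply: eq_bigr => b _; rewrite mulr_sumr.
rewrite (bigD1_seq 0) ?fset_uniq //= [X in _ + X]big1 ?addr0 => [|b b0]; last first.
  rewrite big1 // => la _; rewrite /Y.
  rewrite (@zmode_sb_state k G B _ (mwt la) s _ _ (@fwt_deltaB k _ la)) //.
  rewrite big1 ?mulr0 // => p _; rewrite (@supp_nprod (- b)) ?mulr0 //.
    by move=> y yb; rewrite /deltaB; case: (y =P _) yb => [->|//]; rewrite eqxx.
  apply: contraNneq b0 => /= /rowP E; apply/eqP/rowP => j; have := E j.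
  by rewrite !mxE; move: (b 0 j) => z; clear; lia.
rewrite q0 subn0 -(@trace_sb_state _ _ _ _ _ _ _ _ leK) mulr_sumr.
by apply: eq_bigr => la _; rewrite /Y oppr0.
Qed.

Lemma ftrace_id eps be : ftrace eps be (fun f : fvec k => f) = fchar k eps.
Proof.
apply/funext => N; rewrite ftraceE; apply: eq_bigr => la _.
by rewrite /deltaB eqxx mulr1.
Qed.

(** The normalisation in Wick's formula is the value on the empty word, the bare character. *)
Lemma sb_eval_wick p (i : 'I_p -> 'I_k) (n : 'I_p -> nat) eps be K :
  sb_eval [seq (i j, n j) | j <- enum 'I_p] (tr eps be K) =
  fchar k eps * wick [set: 'I_p] (fun j => bmean G B be (i j, n j))
                   (fun r x => bcov eps K (i r, n r) (i x, n x)).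
Proof.
have -> : enum 'I_p = enum (mem ([set: 'I_p] : {set 'I_p})) by apply: eq_enum => j; rewrite finset.in_setT.
rewrite (@wick_unique _ p _ (bmean G B be) (bcov eps K)
          (fun s => sb_eval s (tr eps be K)) (fun j => (i j, n j))).
  by rewrite -(ftrace_id eps be).
move=> an s; rewrite (state_eval_rec _ _ (ftrace_nprod_rec G B eps be K)).
by [].
Qed.

Lemma pairings_eqmod p N (A : {set 'I_p}) (w w' : 'I_p -> 'I_p -> psring) :
  (forall r x, ps_eqmod N (w r x) (w' r x)) ->
  ps_eqmod N (pairings A w) (pairings A w').
Proof.
move=> H; apply: ps_eqmod_sum => s _; apply: ps_eqmod_prod => r _; exact: H.
Qed.

Section Words.
Variables (p : nat) (i : 'I_p -> 'I_k) (n : 'I_p -> nat).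
Hypothesis npos : forall j, (0 < n j)%N.
Let U := [seq (i j, n j) | j <- enum 'I_p].
Let Lam := [set j : 'I_p | n j == 1%N].
Let EE (r s : 'I_p) : psring := if i r == i s then Ehat (n r) (n s) else ps_zero.
Let FF (r s : 'I_p) : psring := if i r == i s then Fhat (n r) (n s) else ps_zero.

Lemma sb_eval_theta K : ps_eqmod K (sb_eval U (tr (-1) 0 K))
   (pairings [set: 'I_p] FF * fchar k (-1)).
Proof.
rewrite sb_eval_wick mulrC; apply: ps_eqmodM => //.
rewrite /wick (bigD1 finset.set0) /=; last by rewrite finset.sub0set.
rewrite big_set0 mul1r finset.setD0 [X in _ + X]big1 ?addr0 => [|D /andP[_ D0]]; last first.
  have [j jD] := set0Pn _ D0; rewrite (bigD1 j) //= bmeanE //= hpair0.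
  by rewrite if_same rmorph0 !mul0r.
by apply: pairings_eqmod => r x; apply: bcovN1; apply: npos.
Qed.

Lemma sb_eval_lattice K be : ps_eqmod K (sb_eval U (tr 1 be K))
   (\sum_(D : {set 'I_p} | D \subset Lam) psC (\prod_(j in D) hpair G B (i j) be) *
       (fchar k 1 * pairings (~: D) EE)).
Proof.
rewrite sb_eval_wick /wick (bigID (fun D : {set 'I_p} => D \subset Lam)) /=.
rewrite [X in _ + X]big1 ?addr0 => [|D /andP[_ /subsetPn[j jD jL]]]; last first.
  rewrite (bigD1 j) //= bmeanE //= ifF ?rmorph0 ?mul0r //.
  by move: jL; rewrite inE => /negPf.
rewrite (eq_bigl (fun D : {set 'I_p} => D \subset Lam)); last first.
  by move=> D; rewrite finset.subsetT.
rewrite mulr_sumr.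
apply: ps_eqmod_sum => D DL; rewrite mulrCA.
have -> : \prod_(j in D) bmean G B be (i j, n j) = psC (\prod_(j in D) hpair G B (i j) be).
  rewrite rmorph_prod; apply: eq_bigr => j jD; rewrite bmeanE //= ifT //.
  by have := fintype.subsetP DL _ jD; rewrite inE.
apply: ps_eqmodM; first exact: ps_eqmod_refl.
apply: ps_eqmodM; first exact: ps_eqmod_refl.
rewrite finset.setTD.
by apply: pairings_eqmod => r x; apply: bcov1; apply: npos.
Qed.

Lemma ZVL_word : ZVL G B (sb_state G B U) =
  \sum_(D : {set 'I_p} | D \subset Lam)
      (thetaL G (fun al => \prod_(j in D) hpair G B (i j) al) : psring) * etainv k
       * pairings (~: D) EE :> psring.
Proof.
apply/funext => N; rewrite (@ZVL_sb_state _ N N) // ps_sumE.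
under eq_bigr => b _ do rewrite (sb_eval_lattice b (leq_subr _ _)) ps_sumE.
rewrite exchange_big; apply: eq_bigr => D DL /=.
under eq_bigr => b _ do rewrite psCME.
by rewrite theta_sum // fchar1 mulrA.
Qed.

Lemma ZVLplus_word : ZVLplus G B (sb_state G B U) =
  psC (1 / 2) * ZVL G B (sb_state G B U) +
  psC (1 / 2) * (pairings [set: 'I_p] FF * fchar k (-1)) :> psring.
Proof.
apply/funext => N; rewrite psDE !psCME (@ZVLplus_sb_state _ N N) //.
by rewrite (sb_eval_theta (leqnn N)).
Qed.

End Words.

(** The empty word isolates half the trace of the involution, the factor that multiplies the sum
    over \hat F. *)
Lemma ZVLplus_vac : ps_add (ZVLplus G B (@vac k)) (ps_scale (- (1 / 2)) (ZVL G B (@vac k)))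
  = psC (1 / 2) * fchar k (-1) :> psring.
Proof.
apply/funext => N; rewrite /ps_add /ps_scale psCME.
rewrite -[@vac k]/(sb_state G B [::]) (@ZVLplus_sb_state _ N N) //= ftrace_id.
by rewrite mulNr addrAC subrr add0r.
Qed.

End Assembly.

Theorem theorem7p5 (k : nat) (G : 'M[int]_k) (B : 'M[C]_k)
    (p : nat) (i : 'I_p -> 'I_k) (n : 'I_p -> nat) :
  (* L = (Z^k, G) is an even positive-definite lattice of rank k *)
  G^T = G ->
  (forall a : 'rV[int]_k, (2 %| lform G a a)%Z) ->
  (forall a : 'rV[int]_k, a != 0 -> 0 < lform G a a) ->
  (* the rows of B form an orthonormal basis h_1..h_k of H = C (x) L *)
  B *m map_mx intr G *m B^T = 1%:M ->
  (* p even, n_j positive *)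
  ~~ odd p ->
  (forall j, (0 < n j)%N) ->
  let u := sb_state G B [seq (i j, n j) | j <- enum 'I_p] in
  let Lam := [set j : 'I_p | n j == 1%N] in
  ZVLplus G B u =
  ps_add
    (ps_mul
       (inv_sum [set: 'I_p]
          (fun r s => if i r == i s then Fhat (n r) (n s) else ps_zero))
       (ps_add (ZVLplus G B (@vac k)) (ps_scale (- (1 / 2)) (ZVL G B (@vac k)))))
    (ps_scale (1 / 2)
       (\big[ps_add/ps_zero]_(D : {set 'I_p} | D \subset Lam)
          ps_mul
            (ps_mul (thetaL G (fun al => \prod_(j in D) hpair G B (i j) al))
                    (etainv k))
            (inv_sum (~: D)
               (fun r s => if i r == i s then Ehat (n r) (n s) else ps_zero)))).
Proof.
move=> Gsym Geven Gpos orth _ npos u Lam.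
(* Determinants of the orthonormality relation. *)
have Gdet : \det G != 0.
  apply: contra_eq_neq orth => G0; apply/eqP => /(congr1 determinant)/eqP.
  by rewrite !det_mulmx det_map_mx G0 rmorph0 mulr0 mul0r det1 eq_sym oner_eq0.
rewrite ZVLplus_vac // ps_scaleE (ZVLplus_word _ Gsym) // ZVL_word //.
rewrite addrC; congr (_ + _).
by rewrite mulrCA.
Qed.
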